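(* Let $K\subset\mathbb{R}^d$ ($d\ge 3$) be a bounded measurable set. Then the Radon transform of $\chi_K$ in direction $\theta$, that is, the function $$(R_\theta\chi_K)(r)=\lambda^{d-1}\left(K\cap\{x\in\mathbb{R}^d:\langle x,\theta\rangle=r\}\right)\qquad(r\in\mathbb{R}),$$ is absolutely continuous for almost every $\theta\in S^{d-1}$.
   Context: $\chi_K$ is the characteristic function of $K$, $\langle\cdot,\cdot\rangle$ is the standard scalar product on $\mathbb{R}^d$, $S^{d-1}$ is the unit sphere of $\mathbb{R}^d$ (''almost every'' refers to its surface measure), and $\lambda^{d-1}$ is $(d-1)$-dimensional Lebesgue measure on hyperplanes. For each $\theta$, $(R_\theta\chi_K)(r)$ is well defined for almost every $r$. *)

(* Defs.v *)
From HB Require Import structures.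
From mathcomp Require Import all_boot all_order all_algebra.
From mathcomp Require Import all_classical all_reals all_analysis.
From mathcomp Require Import measurable_realfun.

Set Implicit Arguments.
Unset Strict Implicit.
Unset Printing Implicit Defensive.
Import Order.TTheory GRing.Theory Num.Theory.
Import numFieldNormedType.Exports.
Local Open Scope classical_set_scope.
Local Open Scope ring_scope.

(* Borel Lebesgue measure on R^n (as n-tuples), built by iterating the binary
   product measure. *)
Section tuple_cons.
Context d (T : measurableType d) (n : nat).

Definition tuple_cons (p : T * n.-tuple T) : n.+1.-tuple T :=
  [tuple of p.1 :: p.2].

Lemma measurable_tuple_cons : measurable_fun setT tuple_cons.
Proof. by apply: measurable_cons. Qed.

End tuple_cons.

Section product_tuple_measure.
Context d (T : measurableType d) (R : realType) (n : nat).
Variable m1 : {sigma_finite_measure set T -> \bar R}.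
Variable m2 : {sigma_finite_measure set (n.-tuple T) -> \bar R}.

Definition cons_measure : set (n.+1.-tuple T) -> \bar R :=
  pushforward (m1 \x m2)%E (@tuple_cons _ T n).

Let cons_measure0 : cons_measure set0 = 0%E.
Proof. by rewrite /cons_measure /pushforward preimage_set0; exact: measure0. Qed.

Let cons_measure_ge0 A : (0 <= cons_measure A)%E.
Proof. by rewrite /cons_measure /pushforward; exact: measure_ge0. Qed.

Let cons_measure_sigma_additive : semi_sigma_additive cons_measure.
Proof.
have mf := measurable_tuple_cons (T := T) (n := n).
move=> F mF tF mUF; rewrite /cons_measure /pushforward preimage_bigcup.
apply: measure_semi_sigma_additive.
- by move=> k; rewrite -[X in measurable X]setTI; exact: mf.
- by apply/trivIsetP => /= i j _ _ ij; rewrite -preimage_setI;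
    move/trivIsetP : tF => ->//; rewrite preimage_set0.
- by rewrite -preimage_bigcup -[X in measurable X]setTI; exact: mf.
Qed.

HB.instance Definition _ := isMeasure.Build _ _ _ cons_measure
  cons_measure0 cons_measure_ge0 cons_measure_sigma_additive.

Let cons_measure_sigma_finite : sigma_finite setT cons_measure.
Proof.
have /sigma_finiteP[F [TF ndF Foo]] := sigma_finiteT m1.
have /sigma_finiteP[G [TG ndG Goo]] := sigma_finiteT m2.
pose uncons (t : n.+1.-tuple T) : T * n.-tuple T :=
  (thead t, [tuple of behead t]).
have muncons : measurable_fun setT uncons.
  apply/measurable_fun_pair; last exact: measurable_behead.
  exact: measurable_tnth.
have consK : cancel (@tuple_cons _ T n) uncons.
  by move=> [x t]; rewrite /uncons theadE; congr (_, _); exact/val_inj.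
exists (fun k => uncons @^-1` (F k `*` G k)).
  rewrite predeqE => t; split=> // _.
  have [i _ Fi] : (\bigcup_k F k) (uncons t).1 by rewrite -TF.
  have [j _ Gj] : (\bigcup_k G k) (uncons t).2 by rewrite -TG.
  exists (maxn i j) => //; split.
  - by move: (uncons t).1 Fi; exact/subsetPset/ndF/leq_maxl.
  - by move: (uncons t).2 Gj; exact/subsetPset/ndG/leq_maxr.
move=> k; have [mF Fk] := Foo k; have [mG Gk] := Goo k; split.
  by rewrite -[X in measurable X]setTI; apply: muncons => //; exact: measurableX.
rewrite /cons_measure /pushforward -comp_preimage.
rewrite (_ : uncons \o _ = id); last by apply/funext => p; exact: consK.
by rewrite preimage_id product_measure1E// lte_mul_pinfty// ge0_fin_numE.
Qed.

HB.instance Definition _ := Measure_isSigmaFinite.Build _ _ _ cons_measure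
  cons_measure_sigma_finite.

End product_tuple_measure.

Fixpoint lebesgue_tuple (R : realType) (n : nat) :
    {sigma_finite_measure set (n.-tuple (measurableTypeR R)) -> \bar R} :=
  match n with
  | 0%N => \d_([tuple] : 0.-tuple (measurableTypeR R))
  | m.+1 => cons_measure (@lebesgue_measure R) (lebesgue_tuple R m)
  end.

Section euclidean.
Context {R : realType}.

Definition row_of_tuple n (t : n.-tuple (measurableTypeR R)) : 'rV[R]_n :=
  \row_i (tnth t i : R).

(* Lebesgue measure on R^n: the outer measure (defined on all sets) and the
   sigma-algebra (completion of the Borel sets) on which it is a measure. *)
Definition lebesgue_rV n (A : set 'rV[R]_n) : \bar R :=
  ((lebesgue_tuple R n)^*)%mu (@row_of_tuple n @^-1` A).

Definition lebesgue_measurable_rV n (A : set 'rV[R]_n) : Prop :=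
  completed_algebra_gen (lebesgue_tuple R n) (@row_of_tuple n @^-1` A).

Definition scalar_product n (x y : 'rV[R]_n) : R := \sum_i x 0 i * y 0 i.

Definition unit_sphere n : set 'rV[R]_n := [set t | scalar_product t t = 1].
Arguments unit_sphere : clear implicits.

Definition cone n (E : set 'rV[R]_n) : set 'rV[R]_n :=
  [set x | exists2 t : R, 0 <= t <= 1 & exists2 e, E e & x = t *: e].

(* Surface measure of E `&` unit_sphere, as n times the volume of the cone
   over it. *)
Definition surface_measure n (E : set 'rV[R]_n) : \bar R :=
  (n%:R%:E * lebesgue_rV (cone (unit_sphere n `&` E)))%E.

Definition ae_sphere n (P : 'rV[R]_n -> Prop) : Prop :=
  surface_measure [set theta | ~ P theta] = 0%E.

Definition hyperplane n (theta : 'rV[R]_n) (r : R) : set 'rV[R]_n :=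
  [set x | scalar_product x theta = r].

(* A matrix whose rows are an orthonormal basis of the orthogonal complement of
   theta; such a matrix exists when theta is a unit vector, and 0 is a dummy
   default for other theta. *)
Definition orthonormal_frame n (theta : 'rV[R]_n) : 'M[R]_(n.-1, n) :=
  xget 0 [set B : 'M[R]_(n.-1, n) | B *m B^T = 1%:M /\ B *m theta^T = 0].

(* (n-1)-dimensional Lebesgue measure on hyperplane theta r, for theta a unit
   vector, transported along the isometry y |-> r *: theta + y *m B from
   R^(n-1); it does not depend on the frame B. *)
Definition hyperplane_measure n (theta : 'rV[R]_n) (r : R)
    (A : set 'rV[R]_n) : \bar R :=
  lebesgue_rV
    [set y : 'rV[R]_n.-1 | A (r *: theta + y *m orthonormal_frame theta)].

Definition radon n (K : set 'rV[R]_n) (theta : 'rV[R]_n) (r : R) : \bar R :=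
  hyperplane_measure theta r (K `&` hyperplane theta r).

Definition absolutely_continuous (f : R -> R) : Prop :=
  forall eps : R, 0 < eps -> exists2 delta : R, 0 < delta &
    forall (n : nat) (a b : 'I_n -> R),
      (forall i, a i <= b i) ->
      trivIset setT (fun i => `]a i, b i[%classic) ->
      \sum_i (b i - a i) < delta ->
      \sum_i `|f (b i) - f (a i)| < eps.

(* For extended-real functions that are meaningful only almost everywhere:
   absolute continuity of a representative. *)
Definition ae_absolutely_continuous (f : R -> \bar R) : Prop :=
  exists2 g : R -> R, absolutely_continuous g &
    {ae (@lebesgue_measure R), forall r, f r = (g r)%:E}.

End euclidean.

(* Main.v *)
From HB Require Import structures.
Require Import Defs.
From mathcomp Require Import all_boot all_order all_algebra.
From mathcomp Require Import all_classical all_reals all_analysis.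
From mathcomp Require Import measurable_realfun ring lra.
Import Order.TTheory GRing.Theory Num.Theory.
Import numFieldNormedType.Exports.
Local Open Scope classical_set_scope.
Local Open Scope ring_scope.

(** Let S_h(r) be the volume of the part of K where r <= <x, w> < r + h.  When w
    ranges over the shell 1 < |w|^2 <= 4 of R^3, the average over w of
    int S_h(r) S_h(r + e) dr is a double integral over the pairs (x, y) in K x K
    of a kernel of z = y - x.  The slices of the shell at heights |t| < 1 all
    have the same area, so <z, w> is uniformly distributed near 0 and the kernels
    for e = 0 and e = h agree unless |z| < 2h.  Hence the average of
    int (S_h(r + h) - S_h(r))^2 dr is O(h * h^3).  In dimension d > 3 this holds
    for the families w = a_0 u + a_1 e_1 + a_2 e_2 with a in the shell and u
    fixed; Fatou's lemma, and Fubini's theorem in (u, a), give for almost every w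
    a sequence h -> 0 along which int (S_h(r + h) - S_h(r))^2 dr = O(h^4).  Since
    S_h(r) is a constant times the integral of the Radon transform over
    [r, r + h[, its difference quotients are then bounded in L^2 along that
    sequence, which makes the transform almost everywhere equal to an absolutely
    continuous function. *)

Set Implicit Arguments.
Unset Strict Implicit.
Unset Printing Implicit Defensive.

(** * Lebesgue measure on tuples *)

Lemma measurable_preimageT d1 d2 (T1 : measurableType d1) (T2 : measurableType d2)
    (f : T1 -> T2) (A : set T2) :
  measurable_fun setT f -> measurable A -> measurable (f @^-1` A).
Proof. by move=> mf mA; rewrite -[X in measurable X]setTI; exact: mf. Qed.

Section image_measure.
Context d1 d2 (X : measurableType d1) (Y : measurableType d2) (R : realType).

Lemma ge0_integral_image_measure (phi : X -> Y) (mu : {measure set X -> \bar R})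
    (nu : {measure set Y -> \bar R}) (f : Y -> \bar R) :
  measurable_fun setT phi ->
  (forall A, measurable A -> nu A = mu (phi @^-1` A)) ->
  measurable_fun setT f -> (forall y, 0 <= f y)%E ->
  (\int[nu]_y f y = \int[mu]_x f (phi x))%E.
Proof.
move=> mphi numu mf f0.
pose m := measure_function_pushforward__canonical__measure_function_Measure mu mphi.
rewrite (eq_measure_integral m); last by move=> A mA _; rewrite numu.
by rewrite /m/= ge0_integral_pushforward.
Qed.

End image_measure.

Section translation1.
Context {R : realType}.
Local Notation mu := (@lebesgue_measure R).

Lemma ge0_integral_lebesgue_shift (c : R) (f : measurableTypeR R -> \bar R) :
  measurable_fun setT f -> (forall r, 0 <= f r)%E ->
  (\int[mu]_r f (r + c)%R = \int[mu]_r f r)%E.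
Proof.
move=> mf f0.
have ms : measurable_fun setT (fun r : measurableTypeR R => r + c : measurableTypeR R).
  exact: measurable_funD.
apply/esym/(ge0_integral_image_measure ms) => // A mA.
pose m := measure_function_pushforward__canonical__measure_function_Measure mu ms.
apply: (lebesgue_measure_unique (mu := m)) => // _ [[a b]] _ <-.
rewrite /m/= /pushforward (_ : _ @^-1` _ = `]a - c, b - c]%classic); last first.
  by apply/seteqP; split => x /=; rewrite !in_itv/= ltrBlDr lerBrDr.
by rewrite !lebesgue_measure_itv/= !lte_fin ltrD2r; case: ifP => // _; congr (_%:E); ring.
Qed.
End translation1.

Section lebesgue_tuple.
Context {R : realType}.
Local Notation V n := (n.-tuple (measurableTypeR R)).
Local Notation lam n := (lebesgue_tuple R n).
Local Notation mu := (@lebesgue_measure R).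
Implicit Types n : nat.

Lemma ge0_integral_lebesgue_tupleS n (f : V n.+1 -> \bar R) :
  measurable_fun setT f -> (forall t, 0 <= f t)%E ->
  (\int[lam n.+1]_t f t = \int[mu]_x \int[lam n]_t f (tuple_cons (x, t)))%E.
Proof.
move=> mf f0.
rewrite (ge0_integral_image_measure (phi := @tuple_cons _ _ n) (mu := (mu \x lam n)%E))//;
    last exact: measurable_tuple_cons.
by rewrite fubini_tonelli1//; exact: (measurableT_comp mf (@measurable_tuple_cons _ _ n)).
Qed.

Definition tuple_add n (t v : V n) : V n := [tuple (tnth t i + tnth v i)%R | i < n].
Definition tuple_opp n (t : V n) : V n := [tuple (- tnth t i)%R | i < n].

Lemma measurable_tuple_add d (T : measurableType d) n (f g : T -> V n) :
  measurable_fun setT f -> measurable_fun setT g ->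
  measurable_fun setT (fun x => tuple_add (f x) (g x)).
Proof.
move=> mf mg; apply/measurable_fun_tnthP => i.
rewrite [X in measurable_fun _ X](_ : _ = fun x => tnth (f x) i + tnth (g x) i); last first.
  by apply/funext => x /=; rewrite tnth_mktuple.
by apply: measurable_funD; [move/measurable_fun_tnthP : mf;
    exact|move/measurable_fun_tnthP : mg; exact].
Qed.

Lemma measurable_tuple_opp d (T : measurableType d) n (f : T -> V n) :
  measurable_fun setT f -> measurable_fun setT (fun x => tuple_opp (f x)).
Proof.
move=> mf; apply/measurable_fun_tnthP => i.
rewrite [X in measurable_fun _ X](_ : _ = fun x => - tnth (f x) i); last first.
  by apply/funext => x /=; rewrite tnth_mktuple.
by apply: measurable_funN; move/measurable_fun_tnthP : mf; exact.
Qed.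

Lemma tuple_add_cons n x (t : V n) (v : V n.+1) :
  tuple_add (tuple_cons (x, t)) v = tuple_cons (x + thead v, tuple_add t [tuple of behead v]).
Proof.
apply/eq_from_tnth => i; rewrite tnth_mktuple.
case: (unliftP ord0 i) => [j ->|->] /=; last by rewrite !tnth0.
by rewrite !tnthS tnth_mktuple tnth_behead; congr (_ + tnth _ _); apply/val_inj;
    rewrite /= inordK// ltnS.
Qed.

Lemma ge0_integral_lebesgue_tuple_shift n (v : V n) (f : V n -> \bar R) :
  measurable_fun setT f -> (forall r, 0 <= f r)%E ->
  (\int[lam n]_t f (tuple_add t v) = \int[lam n]_t f t)%E.
Proof.
elim: n v f => [|n ih] v f mf f0.
  by apply: eq_integral => t _; congr f; rewrite [LHS]tuple0 [RHS]tuple0.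
rewrite !ge0_integral_lebesgue_tupleS//; last first.
  by apply: measurableT_comp => //; apply: measurable_tuple_add.
have mF : measurable_fun setT (fun x : measurableTypeR R => \int[lam n]_t f (tuple_cons
    (x, t)))%E.
  apply: (measurable_fun_fubini_tonelli_F (m2 := lam n) (f \o @tuple_cons _ _ n)).
  - exact: (measurableT_comp mf (@measurable_tuple_cons _ _ n)).
  - by move=> x /=.
rewrite -(ge0_integral_lebesgue_shift (thead v) mF); last by move=> r; exact: integral_ge0.
apply: eq_integral => x _.
under eq_integral do rewrite tuple_add_cons.
apply: (ih _ (fun t => f (tuple_cons (x + thead v, t)))) => //.
apply: (measurableT_comp mf); apply: (measurableT_comp (@measurable_tuple_cons _ _ n)).
exact: measurable_fun_pair.
Qed.

Lemma measurable_tuple_box n (a b : V n) :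
  measurable [set t : V n | forall i, tnth a i <= tnth t i <= tnth b i].
Proof.
rewrite (_ : mkset _ = \bigcap_i [set t : V n | tnth a i <= tnth t i <= tnth b i]); last first.
  by apply/seteqP; split => [t h i _|t h i]; [exact: h|exact: h].
apply: fin_bigcap_measurable => // i _.
rewrite (_ : mkset _ = (@tnth _ _ ^~ i) @^-1` `[tnth a i : R, tnth b i]%classic).
  by apply: measurable_preimageT; first exact: measurable_tnth.
by apply/seteqP; split => t /=; rewrite in_itv.
Qed.

Lemma lebesgue_tuple_box n (a b : V n) : (forall i, tnth a i <= tnth b i) ->
  lam n [set t | forall i, tnth a i <= tnth t i <= tnth b i] =
  (\prod_i (tnth b i - tnth a i))%:E.
Proof.
elim: n a b => [|n ih] a b ab.
  rewrite big_ord0/= /dirac indicE mem_set//=.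
  by move=> [].
rewrite /= /cons_measure /pushforward.
rewrite [X in (mu \x _)%E X](_ : _ = `[thead a, thead b]%classic `*`
  [set t : V n | forall i, tnth [tuple of behead a] i <= tnth t i <= tnth [tuple of behead b]
      i]); last first.
  apply/seteqP; split => [[x t]/= h|[x t]/= [h1 h2] i].
    split; first by have := h ord0; rewrite tnth0 in_itv.
    move=> i; have := h (lift ord0 i); rewrite tnthS !tnth_behead.
    by rewrite (_ : inord i.+1 = lift ord0 i)//; apply/val_inj; rewrite /= inordK// ltnS.
  case: (unliftP ord0 i) => [j ->|->] /=; last by move: h1; rewrite tnth0 in_itv.
  rewrite tnthS; have := h2 j; rewrite !tnth_behead.
  by rewrite (_ : inord j.+1 = lift ord0 j)//; apply/val_inj; rewrite /= inordK// ltnS.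
have E i (c : V n.+1) : tnth [tuple of behead c] i = tnth c (lift ord0 i).
  by rewrite tnth_behead; congr tnth; apply/val_inj; rewrite /= inordK// ltnS.
rewrite product_measure1E//; last exact: measurable_tuple_box.
rewrite big_ord_recl EFinM; congr (_ * _)%E.
  rewrite [LHS]lebesgue_measure_itv/= lte_fin; case: ltP => // h.
  by congr (_%:E); apply/esym/eqP; rewrite subr_eq0 eq_le h; exact: ab.
rewrite ih; last by move=> i; rewrite !E.
by congr (_%:E); apply: eq_bigr => i _; rewrite !E.
Qed.

End lebesgue_tuple.

Section linear_maps.
Context {R : realType}.
Local Notation V n := (n.-tuple (measurableTypeR R)).
Local Notation lam n := (lebesgue_tuple R n).
Implicit Types n m : nat.

Definition tuple_of_row n (u : 'rV[R]_n) : V n := [tuple u 0 i | i < n].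

Lemma row_of_tupleK n : cancel (@row_of_tuple R n) (@tuple_of_row n).
Proof. by move=> t; apply/eq_from_tnth => i; rewrite tnth_mktuple mxE. Qed.

Lemma tuple_of_rowK n : cancel (@tuple_of_row n) (@row_of_tuple R n).
Proof. by move=> u; apply/rowP => i; rewrite mxE tnth_mktuple. Qed.

Lemma row_of_tupleD n (t v : V n) :
  row_of_tuple (tuple_add t v) = row_of_tuple t + row_of_tuple v.
Proof. by apply/rowP => i; rewrite !mxE tnth_mktuple. Qed.

Lemma row_of_tupleN n (t : V n) : row_of_tuple (tuple_opp t) = - row_of_tuple t.
Proof. by apply/rowP => i; rewrite !mxE tnth_mktuple. Qed.

Definition tuple_mul n m (M : 'M[R]_(n, m)) (t : V n) : V m :=
  tuple_of_row (row_of_tuple t *m M).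

Lemma measurable_tuple_mul d (T : measurableType d) n m (M : 'M[R]_(n, m)) (f : T -> V n) :
  measurable_fun setT f -> measurable_fun setT (fun x => tuple_mul M (f x)).
Proof.
move=> mf; apply/measurable_fun_tnthP => i.
rewrite [X in measurable_fun _ X](_ : _ = fun x => \sum_j (tnth (f x) j : R) * M j i); last first.
  by apply/funext => x /=; rewrite tnth_mktuple mxE; apply: eq_bigr => j _; rewrite mxE.
apply: measurable_sum => j; apply: measurable_funM => //.
by move/measurable_fun_tnthP : mf; exact.
Qed.

Lemma measurable_indic_comp d1 d2 (T1 : measurableType d1) (T2 : measurableType d2)
    (f : T1 -> T2) (A : set T2) :
  measurable_fun setT f -> measurable A -> measurable_fun setT (fun x => \1_A (f x) : R).
Proof. by move=> mf mA; apply: measurableT_comp => //; exact: measurable_indic. Qed.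

(* Both sides are the integral of 1_E(x + My) 1_F(My) over (x, y): integrate
   first in x, or translate y by - M^-1 x before integrating in y. *)
Lemma lebesgue_tuple_haar n (M : 'M[R]_n) (E F : set (V n)) : M \in unitmx ->
  measurable E -> measurable F ->
  (lam n E * lam n (tuple_mul M @^-1` F) =
   lam n (tuple_mul M @^-1` E) * lam n (@tuple_opp R n @^-1` F))%E.
Proof.
move=> uM mE mF.
have mM : measurable_fun setT (@tuple_mul n n M) by exact: measurable_tuple_mul.
have mN : measurable_fun setT (@tuple_opp R n) by exact: measurable_tuple_opp.
pose g (p : V n * V n) := (\1_E (tuple_add p.1 (tuple_mul M p.2)) * \1_F
    (tuple_mul M p.2) : R)%:E.
pose k (p : V n * V n) := (\1_E (tuple_mul M p.2) * \1_F (tuple_add (tuple_opp p.1)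
    (tuple_mul M p.2)) : R)%:E.
have mg : measurable_fun setT g.
  apply/measurable_EFinP; apply: measurable_funM.
    by apply: measurable_indic_comp => //; apply: measurable_tuple_add => //;
        exact: measurable_tuple_mul.
  by apply: measurable_indic_comp => //; exact: measurable_tuple_mul.
have mk : measurable_fun setT k.
  apply/measurable_EFinP; apply: measurable_funM.
    by apply: measurable_indic_comp => //; exact: measurable_tuple_mul.
  by apply: measurable_indic_comp => //; apply: measurable_tuple_add => //;
    [exact: measurable_tuple_opp|exact: measurable_tuple_mul].
have g0 p : (0 <= g p)%E by rewrite lee_fin mulr_ge0.
have k0 p : (0 <= k p)%E by rewrite lee_fin mulr_ge0.
transitivity (\int[lam n]_y \int[lam n]_x g (x, y))%E.
  transitivity (\int[lam n]_y (lam n E * (\1_F (tuple_mul M y))%:E))%E.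
    rewrite ge0_integralZl//; last exact/measurable_EFinP/measurable_indic_comp.
    congr (_ * _)%E; rewrite -[X in _ = integral _ _ X]/(fun y =>
        (\1_(tuple_mul M @^-1` F) y)%:E).
    by rewrite integral_indic// ?setIT//; exact: measurable_preimageT.
  apply: eq_integral => y _; rewrite /g/=.
  under eq_integral do rewrite EFinM muleC.
  rewrite ge0_integralZl//; last first.
    by apply/measurable_EFinP; apply: measurable_indic_comp => //; exact: measurable_tuple_add.
  rewrite muleC; congr (_ * _)%E.
  rewrite (ge0_integral_lebesgue_tuple_shift _ (f := fun x => (\1_E x)%:E))//.
    by rewrite integral_indic// setIT.
  exact/measurable_EFinP/measurable_indic.
rewrite -fubini_tonelli//.
transitivity (\int[lam n]_x \int[lam n]_y k (x, y))%E.
  apply: eq_integral => x _.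
  rewrite -(ge0_integral_lebesgue_tuple_shift (tuple_mul (invmx M) (tuple_opp x))
      (f := fun y => g (x, y)))//; last first.
    exact: measurableT_comp.
  apply: eq_integral => y _; rewrite /g /k/=.
  have -> : tuple_mul M (tuple_add y (tuple_mul (invmx M) (tuple_opp x))) =
            tuple_add (tuple_opp x) (tuple_mul M y).
    apply: (can_inj (@row_of_tupleK n)).
    by rewrite row_of_tupleD !tuple_of_rowK row_of_tupleD mulmxDl tuple_of_rowK -mulmxA mulVmx//
        mulmx1 addrC.
  congr (\1_E _ * _)%:E; apply: (can_inj (@row_of_tupleK n)).
  by rewrite !row_of_tupleD row_of_tupleN addrA subrr add0r.
rewrite fubini_tonelli//.
transitivity (\int[lam n]_y ((\1_E (tuple_mul M y))%:E * lam n (@tuple_opp R n @^-1` F)))%E.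
  apply: eq_integral => y _; rewrite /k/=.
  under eq_integral do rewrite EFinM.
  rewrite ge0_integralZl//; last first.
    by apply/measurable_EFinP; apply: measurable_indic_comp => //; apply: measurable_tuple_add.
  congr (_ * _)%E.
  rewrite -(ge0_integral_lebesgue_tuple_shift (tuple_mul M y)); last 2 first.
    by apply/measurable_EFinP; apply: measurable_indic_comp => //; apply: measurable_tuple_add.
    by move=> ?; rewrite lee_fin.
  transitivity (\int[lam n]_x (\1_(@tuple_opp R n @^-1` F) x)%:E)%E.
    apply: eq_integral => x _; rewrite -[RHS]/((\1_F (tuple_opp x))%:E).
    congr (\1_F _)%:E; apply: (can_inj (@row_of_tupleK n)).
    by rewrite row_of_tupleD !row_of_tupleN row_of_tupleD opprD subrK.
  by rewrite integral_indic// ?setIT//; exact: measurable_preimageT.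
rewrite ge0_integralZr//; last exact/measurable_EFinP/measurable_indic_comp.
congr (_ * _)%E; rewrite -[X in integral _ _ X]/(fun y => (\1_(tuple_mul M @^-1` E) y)%:E).
by rewrite integral_indic// ?setIT//; exact: measurable_preimageT.
Qed.

Definition cube n (r : R) : set (V n) := [set t : V n | forall i, - r <= tnth t i <= r].

Arguments cube : clear implicits.

Lemma cubeE n r : cube n r = [set t : V n | forall i,
  tnth [tuple - r | _ < n] i <= tnth t i <= tnth [tuple r | _ < n] i].
Proof. by apply/seteqP; split => t h i; have := h i; rewrite !tnth_mktuple. Qed.

Lemma measurable_cube n r : measurable (cube n r).
Proof. by rewrite cubeE; exact: measurable_tuple_box. Qed.

Lemma lebesgue_tuple_cube n r : 0 <= r -> lam n (cube n r) = ((r *+ 2) ^+ n)%:E.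
Proof.
move=> r0; rewrite cubeE lebesgue_tuple_box; last first.
  by move=> i; rewrite !tnth_mktuple (le_trans _ r0)// oppr_le0.
congr (_%:E); under eq_bigr do rewrite !tnth_mktuple opprK -mulr2n.
by rewrite prodr_const card_ord.
Qed.

Lemma tuple_mul_cube n (M : 'M[R]_n) r : 0 <= r -> exists2 s, 0 <= s & 
  tuple_mul M @` cube n r `<=` cube n s.
Proof.
move=> r0; exists (\sum_i \sum_j r * `|M j i|).
  by apply: sumr_ge0 => i _; apply: sumr_ge0 => j _; rewrite mulr_ge0.
move=> _ [t ct <-] i; rewrite -ler_norml tnth_mktuple mxE.
rewrite (le_trans (ler_norm_sum _ _ _))// [leRHS](bigD1 i)//= ler_wpDr//.
  by apply: sumr_ge0 => k _; apply: sumr_ge0 => j _; rewrite mulr_ge0.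
apply: ler_sum => j _; rewrite normrM ler_wpM2r//.
by rewrite mxE ler_norml; exact: ct.
Qed.

Lemma tuple_mulK n (M : 'M[R]_n) : M \in unitmx ->
  cancel (tuple_mul M) (tuple_mul (invmx M)).
Proof. by move=> uM t; rewrite /tuple_mul tuple_of_rowK mulmxK// row_of_tupleK. Qed.

Lemma lebesgue_tuple_mul n (M : 'M[R]_n) : M \in unitmx ->
  exists2 c : R, 0 < c &
  forall E, measurable E -> lam n (tuple_mul M @^-1` E) = (c%:E * lam n E)%E.
Proof.
move=> uM.
have mM : measurable_fun setT (@tuple_mul n n M) by exact: measurable_tuple_mul.
have mC := @measurable_cube n 1.
have NC : @tuple_opp R n @^-1` cube n 1 = cube n 1.
  apply/seteqP; split => t h i.
    by have := h i; rewrite tnth_mktuple lerN2 andbC lerNl.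
  by have := h i; rewrite tnth_mktuple lerN2 andbC lerNl.
have [s s0 Cs] := @tuple_mul_cube n (invmx M) 1 ler01.
have fC : lam n (tuple_mul M @^-1` cube n 1) \is a fin_num.
  rewrite ge0_fin_numE//; apply: (@le_lt_trans _ _ (lam n (cube n s))); last first.
    by rewrite lebesgue_tuple_cube// ltry.
  apply: le_measure; rewrite ?inE//; [exact: measurable_preimageT|exact: measurable_cube|].
  by move=> t /= ht; apply: Cs; exists (tuple_mul M t) => //; rewrite tuple_mulK.
have p2 : (2 ^+ n : R) != 0 by rewrite expf_neq0.
pose c := fine (lam n (tuple_mul M @^-1` cube n 1)) / 2 ^+ n.
have H E : measurable E -> lam n (tuple_mul M @^-1` E) = (c%:E * lam n E)%E.
  move=> mE; have := lebesgue_tuple_haar uM mE mC.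
  rewrite NC (lebesgue_tuple_cube _ ler01) -(fineK fC) => h.
  rewrite /c mulrC EFinM -muleA [X in (_ * X)%E]muleC h muleC -muleA -EFinM divff//.
  by rewrite mule1.
exists c => //; rewrite lt_neqAle; apply/andP; split; last by rewrite divr_ge0// fine_ge0.
apply/negP => /eqP c0; have := H _ (@measurableT _ (V n)).
rewrite -c0 mul0e preimage_setT => h0.
have : (lam n (cube n 1) <= lam n setT)%E by apply: le_measure; rewrite ?inE.
by rewrite h0 lebesgue_tuple_cube// lee_fin leNgt exprn_gt0.
Qed.

Lemma ge0_integral_tuple_mul n (M : 'M[R]_n) : M \in unitmx ->
  exists2 c : R, 0 < c &
  (forall E, measurable E -> lam n (tuple_mul M @^-1` E) = (c%:E * lam n E)%E) /\
  forall f : V n -> \bar R, measurable_fun setT f -> (forall t, 0 <= f t)%E ->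
   (\int[lam n]_t f (tuple_mul M t) = c%:E * \int[lam n]_t f t)%E.
Proof.
move=> uM; have [c c0 H] := lebesgue_tuple_mul uM; exists c => //; split => // f mf f0.
rewrite -(ge0_integral_image_measure (phi := tuple_mul M) (nu := mscale (NngNum (ltW c0))
    (lam n)))//.
- by rewrite ge0_integral_mscale.
- exact: measurable_tuple_mul.
- by move=> A mA; exact/esym/H.
Qed.

End linear_maps.
Arguments cube {R} n r _.

(** * Orthonormal frames *)

Section orthonormal_frames.
Context {R : realType}.
Implicit Types n : nat.

Lemma scalar_productE n (x y : 'rV[R]_n) : scalar_product x y = (x *m y^T) 0 0.
Proof. by rewrite mxE; apply: eq_bigr => i _; rewrite mxE. Qed.

Lemma mulmx_trE n (x y : 'rV[R]_n) : x *m y^T = (scalar_product x y)%:M.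
Proof. by rewrite [LHS]mx11_scalar scalar_productE. Qed.

Lemma scalar_productC n (x y : 'rV[R]_n) : scalar_product x y = scalar_product y x.
Proof. by apply: eq_bigr => i _; rewrite mulrC. Qed.

Lemma scalar_productDl n (x y z : 'rV[R]_n) :
  scalar_product (x + y) z = scalar_product x z + scalar_product y z.
Proof. by rewrite !scalar_productE mulmxDl mxE. Qed.

Lemma scalar_productNl n (x z : 'rV[R]_n) : scalar_product (- x) z = - scalar_product x z.
Proof. by rewrite !scalar_productE mulNmx mxE. Qed.

Lemma scalar_productBl n (x y z : 'rV[R]_n) :
  scalar_product (x - y) z = scalar_product x z - scalar_product y z.
Proof. by rewrite scalar_productDl scalar_productNl. Qed.

Lemma scalar_productZl n a (x z : 'rV[R]_n) : scalar_product (a *: x) z = a * scalar_product x z.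
Proof. by rewrite !scalar_productE -scalemxAl mxE. Qed.

Lemma scalar_productDr n (x y z : 'rV[R]_n) :
  scalar_product z (x + y) = scalar_product z x + scalar_product z y.
Proof. by rewrite ![scalar_product z _]scalar_productC scalar_productDl. Qed.

Lemma scalar_productZr n a (x z : 'rV[R]_n) : scalar_product z (a *: x) = a * scalar_product z x.
Proof. by rewrite ![scalar_product z _]scalar_productC scalar_productZl. Qed.

Lemma scalar_product_ge0 n (x : 'rV[R]_n) : 0 <= scalar_product x x.
Proof. by apply: sumr_ge0 => i _; rewrite -expr2 sqr_ge0. Qed.

Lemma scalar_product_eq0 n (x : 'rV[R]_n) : scalar_product x x = 0 -> x = 0.
Proof.
move/eqP; rewrite psumr_eq0 => [/allP h|i _]; last by rewrite -expr2 sqr_ge0.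
apply/rowP => i; rewrite mxE; apply/eqP.
by have := h i (mem_index_enum _); rewrite /= -expr2 sqrf_eq0.
Qed.

(* The Householder reflection exchanging theta and the first basis vector *)
Lemma orthogonal_first_row n (theta : 'rV[R]_(1 + n)) : scalar_product theta theta = 1 ->
  exists2 H : 'M[R]_(1 + n), H *m H^T = 1%:M & usubmx H = theta.
Proof.
move=> tt; pose e : 'rV[R]_(1 + n) := row_mx 1%:M 0.
have ee : scalar_product e e = 1.
  by rewrite scalar_productE tr_row_mx mul_row_col mul0mx addr0 trmx1 mulmx1 mxE.
have ue : usubmx (1%:M : 'M[R]_(1 + n)) = e.
  by rewrite (scalar_mx_block 1 n 1) /block_mx col_mxKu.
have [->|te] := eqVneq theta e.
  by exists 1%:M; rewrite ?trmx1 ?mulmx1.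
have [v vE] : exists v, v = theta - e by exists (theta - e).
have vv0 : scalar_product v v != 0.
  by apply: contra te => /eqP /scalar_product_eq0 /eqP; rewrite vE subr_eq0.
pose H : 'M[R]_(1 + n) := 1%:M - (2 / scalar_product v v) *: (v^T *m v).
have HT : H^T = H.
  by rewrite /H linearB/= trmx1 linearZ/= trmx_mul trmxK.
exists H.
  rewrite HT /H; set a := 2 / _.
  have PP : v^T *m v *m (v^T *m v) = scalar_product v v *: (v^T *m v).
    by rewrite -mulmxA (mulmxA v) mulmx_trE mul_scalar_mx -scalemxAr.
  rewrite mulmxBl mul1mx mulmxBr mulmx1 -scalemxAl -scalemxAr PP !scalerA.
  have -> : a * a * scalar_product v v = a * 2 by rewrite -mulrA divfK.
  rewrite -scalerBl (_ : a - a * 2 = - a); last by ring.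
  by rewrite scaleNr opprK subrK.
rewrite /H linearB/= ue.
have -> : usubmx ((2 / scalar_product v v) *: (v^T *m v)) =
   (2 / scalar_product v v * scalar_product e v) *: v.
  rewrite linearZ/= -[RHS]scalerA; congr (_ *: _).
  rewrite -[v^T *m v in LHS]mul1mx -mul_usub_mx ue mulmxA mulmx_trE.
  by rewrite mul_scalar_mx.
have evE : 2 * scalar_product e v = - scalar_product v v.
  rewrite vE scalar_productDr -scaleN1r scalar_productZr.
  rewrite scalar_productDl scalar_productZl !scalar_productDr !scalar_productZr.
  by rewrite tt ee (scalar_productC theta e); ring.
by rewrite mulrAC evE mulNr divff// scaleN1r opprK vE addrC subrK.
Qed.

Lemma orthonormal_frame_exists n (theta : 'rV[R]_(1 + n)) : scalar_product theta theta = 1 ->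
  exists B : 'M[R]_(n, 1 + n), B *m B^T = 1%:M /\ B *m theta^T = 0.
Proof.
move=> /orthogonal_first_row[H HH Ht]; exists (dsubmx H).
have := HH; rewrite -[H in H *m _]vsubmxK -[H in _ *m H^T]vsubmxK tr_col_mx mul_col_row.
rewrite scalar_mx_block => /eq_block_mx[_ _ h1 h2].
by split => //; rewrite -Ht.
Qed.

Lemma col_mx_orthogonal n (theta : 'rV[R]_(1 + n)) (B : 'M[R]_(n, 1 + n)) :
  scalar_product theta theta = 1 -> B *m B^T = 1%:M -> B *m theta^T = 0 ->
  col_mx theta B *m (col_mx theta B)^T = 1%:M.
Proof.
move=> tt BB Bt; rewrite tr_col_mx mul_col_row BB Bt mulmx_trE tt scalar_mx_block.
by congr block_mx; rewrite -[RHS]trmx0 -Bt trmx_mul trmxK.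
Qed.

End orthonormal_frames.

(** * The kernel of the shell in dimension 3 *)

Section windows.
Context {R : realType}.
Local Notation mu := (@lebesgue_measure R).
Implicit Types h r a b c e : R.

Definition window h r a : R := (r <= a < r + h)%R%:R.

Lemma window_ge0 h r a : 0 <= window h r a.
Proof. by rewrite ler0n. Qed.

Lemma window_le1 h r a : window h r a <= 1.
Proof. by rewrite lern1 leq_b1. Qed.

Lemma window_shift h r a e : window h (r + e) (a + e) = window h r a.
Proof. by rewrite /window lerD2r addrAC ltrD2r. Qed.

Lemma windowE h r a : window h r a = \1_(`]a - h, a]) r.
Proof. by rewrite /window indicE mem_setE in_itv/= andbC ltrBlDr. Qed.

Lemma measurable_fun_window d (T : measurableType d) h (f g : T -> R) :
  measurable_fun setT f -> measurable_fun setT g ->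
  measurable_fun setT (fun x => window h (f x) (g x)).
Proof.
move=> mf mg.
rewrite [X in measurable_fun _ X](_ : _ = (fun b : bool => b%:R : R) \o (fun x =>
    (f x <= g x) && (g x < f x + h)))//.
apply: measurableT_comp; first by [].
by apply: measurable_and; [exact: measurable_fun_ler|apply: measurable_fun_ltr => //;
    exact: measurable_funD].
Qed.

Definition overlap h c : \bar R := (\int[mu]_r (window h r 0 * window h r c)%:E)%E.

Lemma overlap_ge0 h c : (0 <= overlap h c)%E.
Proof. by apply: integral_ge0 => r _; rewrite lee_fin mulr_ge0// window_ge0. Qed.

Lemma measurable_overlap h : measurable_fun setT (overlap h : measurableTypeR R -> \bar R).
Proof.
apply: (measurable_fun_fubini_tonelli_F (m2 := mu)
    (fun p : measurableTypeR R * measurableTypeR R => (window h p.2 0 * window h p.2 p.1)%:E)).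
  by apply/measurable_EFinP; apply: measurable_funM; exact: measurable_fun_window.
by move=> p; rewrite lee_fin mulr_ge0// window_ge0.
Qed.

Lemma integral_window2 h e a b :
  (\int[mu]_r (window h r a * window h (r + e) b)%:E = overlap h (b - a - e))%E.
Proof.
rewrite -(ge0_integral_lebesgue_shift a).
- apply: eq_integral => r _; rewrite -{2}[a]add0r window_shift; congr (_ * _)%:E.
  by rewrite -(window_shift _ _ (b - a - e) (a + e)) addrA; congr window; ring.
- by apply/measurable_EFinP; apply: measurable_funM; apply: measurable_fun_window => //;
    exact: measurable_funD.
- by move=> r; rewrite lee_fin mulr_ge0// window_ge0.
Qed.

Lemma overlap_le h c : 0 <= h -> (overlap h c <= h%:E)%E.
Proof.
move=> h0; have -> : h%:E = (\int[mu]_r (window h r 0)%:E)%E.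
  under eq_integral do rewrite windowE.
  rewrite integral_indic// setIT [RHS]lebesgue_measure_itv/= lte_fin.
  by case: ltP => h1; rewrite -?EFinB; congr (_%:E); lra.
apply: ge0_le_integral => //.
- by move=> r _; rewrite lee_fin mulr_ge0// window_ge0.
- by apply/measurable_EFinP; apply: measurable_funM; apply: measurable_fun_window.
- by apply/measurable_EFinP; apply: measurable_fun_window.
- by move=> r _; rewrite lee_fin ler_piMr ?window_ge0// window_le1.
Qed.

Lemma overlap_eq0 h c : h <= `|c| -> overlap h c = 0%E.
Proof.
move=> hc; apply: integral0_eq => r _; congr (_%:E); rewrite /window.
case: andP => [[r0 r1]|]; last by rewrite mul0r.
case: andP => [[r2 r3]|]; last by rewrite mulr0.
move: hc; case: ger0P => c0; lra.
Qed.

End windows.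

Section shell.
Context {R : realType}.
Local Notation V n := (n.-tuple (measurableTypeR R)).
Local Notation lam n := (lebesgue_tuple R n).
Local Notation mu := (@lebesgue_measure R).

Definition tdot n (t v : V n) : R := scalar_product (row_of_tuple t) (row_of_tuple v).

Lemma tdotE n (t v : V n) : tdot t v = \sum_i (tnth t i : R) * tnth v i.
Proof. by apply: eq_bigr => i _; rewrite !mxE. Qed.

Lemma tdotC n (t v : V n) : tdot t v = tdot v t.
Proof. exact: scalar_productC. Qed.

Lemma measurable_tdot d (T : measurableType d) n (f g : T -> V n) :
  measurable_fun setT f -> measurable_fun setT g ->
  measurable_fun setT (fun x => tdot (f x) (g x)).
Proof.
move=> mf mg.
rewrite [X in measurable_fun _ X](_ : _ = fun x => \sum_j (tnth (f x) j : R) * tnth (g x) j);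
    last first.
  by apply/funext => x /=; rewrite tdotE.
apply: measurable_sum => j; apply: measurable_funM.
  by move/measurable_fun_tnthP : mf; exact.
by move/measurable_fun_tnthP : mg; exact.
Qed.

Lemma tdot_cons n x y (t v : V n) :
  tdot (tuple_cons (x, t)) (tuple_cons (y, v)) = x * y + tdot t v.
Proof.
rewrite !tdotE big_ord_recl !tnth0; congr (_ + _).
by apply: eq_bigr => i _; rewrite !tnthS.
Qed.

Lemma cube_tdot n (t : V n) s : 0 <= s -> tdot t t <= s ^+ 2 -> cube n s t.
Proof.
move=> s0 ts i; rewrite -ler_norml -ler_sqr ?nnegrE// (le_trans _ ts)//.
rewrite real_normK ?num_real// tdotE (bigD1 i)//= -expr2 lerDl.
by apply: sumr_ge0 => j _; rewrite -expr2 sqr_ge0.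
Qed.

Definition disc n (s : R) : set (V n) := [set t | tdot t t <= s].
Arguments disc : clear implicits.

Lemma measurable_disc n s : measurable (disc n s).
Proof.
rewrite (_ : disc n s = (fun t => tdot t t) @^-1` `]-oo, s]%classic); last first.
  by apply/seteqP; split => t /=; rewrite in_itv.
by apply: measurable_preimageT => //; exact: measurable_tdot.
Qed.

Lemma lebesgue_disc_fin_num n s : lam n (disc n s) \is a fin_num.
Proof.
rewrite ge0_fin_numE//; have s0 : 0 <= Num.max s 0 + 1 by rewrite addr_ge0// le_max lexx orbT.
apply: (@le_lt_trans _ _ (lam n (cube n (Num.max s 0 + 1)))); last first.
  by rewrite lebesgue_tuple_cube// ltry.
apply: le_measure; rewrite ?inE; [exact: measurable_disc|exact: measurable_cube|].
move=> t ts; apply: cube_tdot => //; rewrite (le_trans ts)//.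
have [sm|] := leP s 0; first by rewrite (le_trans sm)// sqr_ge0.
by move=> s1; nra.
Qed.

Lemma lebesgue_disc2 s : 0 < s -> lam 2 (disc 2 s) = (s%:E * lam 2 (disc 2 1))%E.
Proof.
move=> s0; pose k := (Num.sqrt s)^-1.
have sq0 : 0 < Num.sqrt s by rewrite sqrtr_gt0.
have k0 : 0 < k by rewrite invr_gt0.
have uk : (k%:M : 'M[R]_2) \in unitmx by rewrite unitmxE det_scalar unitfE expf_neq0// gt_eqF.
have E t : row_of_tuple (tuple_mul k%:M t : V 2) = k *: row_of_tuple t.
  by rewrite tuple_of_rowK mul_mx_scalar.
have [c c0 H] := lebesgue_tuple_mul uk.
have cE : c%:E = s%:E.
  have := H _ (@measurable_cube _ 2 1).
  have -> : tuple_mul k%:M @^-1` cube 2 1 = cube 2 (Num.sqrt s).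
    apply/seteqP; split => t h i; have := h i; rewrite -!ler_norml.
      rewrite -[tnth (tuple_mul _ _) i]mulr1; move/(congr1 (fun u : 'rV[R]_2 => u 0 i)) : (E t).
      by rewrite !mxE => ->; rewrite mulr1 normrM gtr0_norm// mulrC ler_pdivrMr// mul1r.
    move/(congr1 (fun u : 'rV[R]_2 => u 0 i)) : (E t).
    by rewrite !mxE => ->; rewrite normrM gtr0_norm// mulrC ler_pdivrMr// mul1r.
  rewrite (lebesgue_tuple_cube _ (ltW sq0)) (lebesgue_tuple_cube _ ler01) -EFinM.
  move=> [] /esym; rewrite -[Num.sqrt s *+ 2]mulr_natr exprMn (sqr_sqrtr (ltW s0)) => hc.
  by congr (_%:E); lra.
rewrite -cE -H; last exact: measurable_disc.
rewrite (_ : disc 2 s = tuple_mul k%:M @^-1` disc 2 1)//.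
apply/seteqP; split => t; rewrite /disc/= /tdot E scalar_productZl scalar_productZr mulrA
  -expr2 exprVn sqr_sqrtr ?(ltW s0)// mulrC ler_pdivrMr// mul1r//.
Qed.

End shell.
Arguments disc {R} n s _.

Section shell_kernel.
Context {R : realType}.
Local Notation V n := (n.-tuple (measurableTypeR R)).
Local Notation lam n := (lebesgue_tuple R n).
Local Notation mu := (@lebesgue_measure R).

Definition shell : set (V 3) := disc 3 4 `\` disc 3 1.

Lemma measurable_shell : measurable shell.
Proof. by apply: measurableD; exact: measurable_disc. Qed.

Lemma tdot_tuple_mul n m (M : 'M[R]_(n, m)) (t : V n) (v : V m) :
  tdot (tuple_mul M t) v = tdot t (tuple_mul M^T v).
Proof.
rewrite /tdot !tuple_of_rowK !scalar_productE trmx_mul trmxK mulmxA.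
by [].
Qed.

(* The area of an annulus depends only on the difference of the squares of its
   radii, which is 3 for all these slices. *)
Lemma shell_slice (x : R) : `|x| < 1 ->
  (\int[lam 2]_t (\1_shell (tuple_cons (x : measurableTypeR R, t)))%:E = 3%:E * lam 2
      (disc 2 1))%E.
Proof.
move=> x1; have xx : x * x < 1 by move: x1; case: ger0P => ? ?; nra.
have x0 : 0 <= x * x by rewrite -expr2 sqr_ge0.
have mD (s : R) := @measurable_disc R 2 s.
transitivity (\int[lam 2]_t (\1_(disc 2 (4 - x * x) `\` disc 2 (1 - x * x)) t)%:E)%E.
  apply: eq_integral => t _; congr (_%:E); rewrite !indicE; congr ((nat_of_bool _)%:R).
  have E : shell (tuple_cons (x : measurableTypeR R, t)) <->
      (disc 2 (4 - x * x) `\` disc 2 (1 - x * x)) t.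
    rewrite /shell /disc /setD /mkset !tdot_cons.
    by split => -[h1 /negP]; rewrite -ltNge => h2; split; [lra|apply/negP; rewrite -ltNge; lra
      |lra|apply/negP; rewrite -ltNge; lra].
  by apply/idP/idP => /set_mem/E/mem_set.
rewrite integral_indic ?setIT//; last exact: measurableD.
rewrite measureD//; last by rewrite ltey_eq lebesgue_disc_fin_num.
rewrite setIidr; last by move=> t; rewrite /disc/=; lra.
transitivity (lam 2 (disc 2 (4 - x * x)) - lam 2 (disc 2 (1 - x * x)))%E; first by [].
rewrite (@lebesgue_disc2 _ (4 - x * x)); last lra.
rewrite (@lebesgue_disc2 _ (1 - x * x)); last lra.
have := lebesgue_disc_fin_num (R := R) 2 1 => /fineK <-.
by rewrite -!EFinM -EFinB; congr (_%:E); ring.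
Qed.

Lemma integral_shell_overlap (p : V 3) h : 0 < h -> (h *+ 2) ^+ 2 <= tdot p p ->
  exists c, forall e, `|e| <= h ->
  (\int[lam 3]_a ((\1_shell a)%:E * overlap h (tdot p a - e)) =
   c * \int[mu]_x overlap h (Num.sqrt (tdot p p) * x - e)%R)%E.
Proof.
move=> h0 hp; set rho := Num.sqrt _.
have rr : rho ^+ 2 = tdot p p by rewrite sqr_sqrtr// scalar_product_ge0.
have rho0 : 0 < rho by rewrite sqrtr_gt0 (lt_le_trans _ hp)// exprn_gt0// mulrn_wgt0.
have hrho : h *+ 2 <= rho.
  by rewrite -ler_sqr ?nnegrE; [rewrite rr|rewrite mulrn_wge0// ltW|exact: ltW].
pose theta : 'rV[R]_(1 + 2) := rho^-1 *: row_of_tuple p.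
have tt : scalar_product theta theta = 1.
  rewrite scalar_productZl scalar_productZr mulrA -expr2 exprVn rr -/(tdot p p) mulVf//.
  by rewrite -rr expf_neq0// gt_eqF.
have [B [BB Bt]] := orthonormal_frame_exists tt.
pose Q : 'M[R]_3 := col_mx theta B.
have QQ : Q *m Q^T = 1%:M by exact: col_mx_orthogonal.
have QtE : col_mx theta B *m theta^T = col_mx 1%:M 0.
  by rewrite mul_col_mx Bt mulmx_trE tt.
have aE (u : 'rV[R]_(1 + 2)) : (u *m col_mx (1%:M : 'M[R]_1) (0 : 'M[R]_(2, 1))) 0 0 = u 0 ord0.
  rewrite -[u in LHS]hsubmxK mul_row_col mulmx1 mulmx0 addr0 !mxE.
  by congr (u _ _); apply/val_inj.
have [uQ _] := mulmx1_unit QQ.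
have [c c0 [_ H]] := ge0_integral_tuple_mul uQ.
exists (c^-1%:E * (3%:E * lam 2 (disc 2 1)))%E => e' he.
have mf : measurable_fun setT (fun a => (\1_shell a)%:E * overlap h (tdot p a - e'))%E.
  apply: emeasurable_funM; first by apply/measurable_EFinP; apply: measurable_indic;
      exact: measurable_shell.
  apply: (measurableT_comp (@measurable_overlap R h)); apply: measurable_funB => //.
  exact: measurable_tdot.
have f0 a : (0 <= (\1_shell a)%:E * overlap h (tdot p a - e'))%E.
  by rewrite mule_ge0// ?overlap_ge0// lee_fin.
have -> : (\int[lam 3]_a ((\1_shell a)%:E * overlap h (tdot p a - e')) =
  c^-1%:E * \int[lam 3]_a ((\1_shell a)%:E * overlap h (rho * tnth a ord0 - e')))%E.
  have := H _ mf f0 => h1; rewrite -[LHS]mul1e -(mulVf (lt0r_neq0 c0)) EFinM -muleA -h1.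
  apply: (congr1 (mule _)); apply: eq_integral => a _.
  have sE : \1_shell (tuple_mul Q a) = \1_shell a :> R.
    have tQ : tdot (tuple_mul Q a) (tuple_mul Q a) = tdot a a.
      rewrite /tdot !tuple_of_rowK !scalar_productE trmx_mul mulmxA.
      by rewrite -[X in (X *m _) 0 0]mulmxA QQ mulmx1.
    by rewrite !indicE; congr ((nat_of_bool _)%:R); apply/idP/idP; rewrite !inE /shell /disc/= tQ.
  rewrite sE (_ : tdot p (tuple_mul Q a) = rho * tnth a ord0)//.
  have pE : row_of_tuple p = rho *: theta by rewrite scalerA divff ?scale1r// gt_eqF.
  rewrite /tdot tuple_of_rowK pE scalar_productZl; congr (_ * _).
  rewrite scalar_productC scalar_productE -mulmxA.
  have -> : Q *m theta^T = col_mx 1%:M 0 :> 'M[R]_(1 + 2, 1).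
    exact: QtE.
  have := aE (row_of_tuple a); rewrite !mxE => <-.
  by [].
rewrite -muleA; congr (_ * _)%E.
rewrite ge0_integral_lebesgue_tupleS//; last 2 first.
- apply: emeasurable_funM; first by apply/measurable_EFinP; apply: measurable_indic;
    exact: measurable_shell.
  apply: (measurableT_comp (@measurable_overlap R h)); apply: measurable_funB => //.
  by apply: measurable_funM => //; exact: measurable_tnth.
- by move=> t; rewrite mule_ge0// ?overlap_ge0// lee_fin.
have mo : measurable_fun setT (fun x : measurableTypeR R => overlap h (rho * x - e')).
  by apply: (measurableT_comp (@measurable_overlap R h)); exact: measurable_funB.
rewrite -ge0_integralZl//; last 2 first.
- by move=> x _; exact: overlap_ge0.
- by rewrite mule_ge0// lee_fin.
apply: eq_integral => x _.
under eq_integral do rewrite tnth0/=.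
rewrite ge0_integralZr//; first last.
- exact: overlap_ge0.
- apply/measurable_EFinP; apply: measurable_indic_comp; last exact: measurable_shell.
  by apply: (measurableT_comp (@measurable_tuple_cons _ _ 2)); exact: measurable_fun_pair.
have [x1|x1] := ltP `|x| 1; first by rewrite shell_slice.
rewrite overlap_eq0 ?mule0//.
have : h *+ 2 - h <= `|rho * x| - `|e'|.
  by rewrite lerB// normrM gtr0_norm// (le_trans hrho)// ler_peMr// ltW.
by rewrite mulr2n addrK => /le_trans; apply; rewrite lerB_dist.
Qed.

Lemma shell_overlap_shift (p : V 3) h : 0 < h -> (h *+ 2) ^+ 2 <= tdot p p ->
  (\int[lam 3]_a ((\1_shell a)%:E * overlap h (tdot p a)) =
   \int[lam 3]_a ((\1_shell a)%:E * overlap h (tdot p a - h)))%E.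
Proof.
move=> h0 hp; have [c H] := integral_shell_overlap h0 hp.
have := H 0; under eq_integral do rewrite subr0; move->; last by rewrite normr0 ltW.
rewrite H; last by rewrite gtr0_norm.
set rho := Num.sqrt _.
have rho0 : 0 < rho by rewrite sqrtr_gt0 (lt_le_trans _ hp)// exprn_gt0// mulrn_wgt0.
congr (_ * _)%E; rewrite -(ge0_integral_lebesgue_shift (- (h / rho))).
- apply: eq_integral => x _; rewrite subr0 mulrDr mulrN mulrCA divff ?mulr1//.
  by rewrite gt_eqF.
- apply: (measurableT_comp (@measurable_overlap R h)); apply: measurable_funB => //.
- by move=> r; exact: overlap_ge0.
Qed.

End shell_kernel.

(** * Iterated integrals *)

Section product_sigma_finite.
Context d1 d2 (T1 : measurableType d1) (T2 : measurableType d2) (R : realType).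
Variable m1 : {sigma_finite_measure set T1 -> \bar R}.
Variable m2 : {sigma_finite_measure set T2 -> \bar R}.

(* An alias: product_measure1 itself is only declared sigma-finite for
   subprobabilities. *)
Definition prod_measure : set (T1 * T2) -> \bar R := (m1 \x m2)%E.

Let prod_measure0 : prod_measure set0 = 0%E.
Proof. exact: measure0. Qed.

Let prod_measure_ge0 A : (0 <= prod_measure A)%E.
Proof. exact: measure_ge0. Qed.

Let prod_measure_sigma_additive : semi_sigma_additive prod_measure.
Proof. exact: measure_semi_sigma_additive. Qed.

HB.instance Definition _ := isMeasure.Build _ _ _ prod_measure
  prod_measure0 prod_measure_ge0 prod_measure_sigma_additive.

Let prod_measure_sigma_finite : sigma_finite setT prod_measure.
Proof.
have /sigma_finiteP[F [TF ndF Foo]] := sigma_finiteT m1.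
have /sigma_finiteP[G [TG ndG Goo]] := sigma_finiteT m2.
exists (fun k => F k `*` G k).
  rewrite predeqE => t; split=> // _.
  have [i _ Fi] : (\bigcup_k F k) t.1 by rewrite -TF.
  have [j _ Gj] : (\bigcup_k G k) t.2 by rewrite -TG.
  exists (maxn i j) => //; split.
  - by move: t.1 Fi; exact/subsetPset/ndF/leq_maxl.
  - by move: t.2 Gj; exact/subsetPset/ndG/leq_maxr.
move=> k; have [mF Fk] := Foo k; have [mG Gk] := Goo k; split.
  exact: measurableX.
by rewrite [ltLHS]product_measure1E// lte_mul_pinfty// ge0_fin_numE.
Qed.

HB.instance Definition _ := Measure_isSigmaFinite.Build _ _ _ prod_measure
  prod_measure_sigma_finite.

Lemma ge0_measurable_integral (F : T1 -> T2 -> \bar R) :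
  measurable_fun setT (fun z => F z.1 z.2) -> (forall x y, 0 <= F x y)%E ->
  measurable_fun setT (fun x => \int[m2]_y F x y)%E.
Proof. by move=> mF F0; apply: (measurable_fun_fubini_tonelli_F (fun z => F z.1 z.2)). Qed.

Lemma ge0_integral_prod_measure (F : T1 -> T2 -> \bar R) :
  measurable_fun setT (fun z => F z.1 z.2) -> (forall x y, 0 <= F x y)%E ->
  (\int[prod_measure]_z F z.1 z.2 = \int[m1]_x \int[m2]_y F x y)%E.
Proof. by move=> mF F0; apply: (fubini_tonelli1 (fun z => F z.1 z.2)). Qed.

Lemma ge0_integral_swap (F : T1 -> T2 -> \bar R) :
  measurable_fun setT (fun z => F z.1 z.2) -> (forall x y, 0 <= F x y)%E ->
  (\int[m1]_x \int[m2]_y F x y = \int[m2]_y \int[m1]_x F x y)%E.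
Proof. by move=> mF F0; apply: (fubini_tonelli (fun z => F z.1 z.2)). Qed.

End product_sigma_finite.

Lemma ge0_integral_swap4 d1 d2 d3 d4 (T1 : measurableType d1) (T2 : measurableType d2)
    (T3 : measurableType d3) (T4 : measurableType d4) (R : realType)
    (m1 : {sigma_finite_measure set T1 -> \bar R})
    (m2 : {sigma_finite_measure set T2 -> \bar R})
    (m3 : {sigma_finite_measure set T3 -> \bar R})
    (m4 : {sigma_finite_measure set T4 -> \bar R})
    (F : T1 -> T2 -> T3 -> T4 -> \bar R) :
  measurable_fun setT (fun z : (T1 * T2) * (T3 * T4) => F z.1.1 z.1.2 z.2.1 z.2.2) ->
  (forall a b c d, 0 <= F a b c d)%E ->
  (\int[m1]_a \int[m2]_b \int[m3]_c \int[m4]_d F a b c d =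
   \int[m3]_c \int[m4]_d \int[m1]_a \int[m2]_b F a b c d)%E.
Proof.
move=> mF F0.
have mF1 a b : measurable_fun setT (fun q : T3 * T4 => F a b q.1 q.2).
  have mq : measurable_fun setT (fun q : T3 * T4 => ((a, b), q)) by exact: measurable_fun_pair.
  exact: (measurableT_comp mF mq).
have mF2 c d : measurable_fun setT (fun q : T1 * T2 => F q.1 q.2 c d).
  have mq : measurable_fun setT (fun q : T1 * T2 => (q, (c, d))) by exact: measurable_fun_pair.
  exact: (measurableT_comp mF mq).
pose m12 : {sigma_finite_measure set (T1 * T2)%type -> \bar R} := prod_measure m1 m2.
pose m34 : {sigma_finite_measure set (T3 * T4)%type -> \bar R} := prod_measure m3 m4.
transitivity (\int[m12]_p \int[m34]_q F p.1 p.2 q.1 q.2)%E.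
  rewrite (@ge0_integral_prod_measure _ _ _ _ _ m1 m2
    (fun a b => \int[m34]_q F a b q.1 q.2))%E; last 2 first.
  - exact: (@ge0_measurable_integral _ _ _ _ _ m34 (fun p q => F p.1 p.2 q.1 q.2)).
  - by move=> a b; exact: integral_ge0.
  apply: eq_integral => a _; apply: eq_integral => b _.
  by rewrite (@ge0_integral_prod_measure _ _ _ _ _ m3 m4 (F a b)).
rewrite (@ge0_integral_swap _ _ _ _ _ m12 m34 (fun p q => F p.1 p.2 q.1 q.2))//.
rewrite (@ge0_integral_prod_measure _ _ _ _ _ m3 m4
    (fun c d => \int[m12]_p F p.1 p.2 c d))%E; last 2 first.
- apply: (@ge0_measurable_integral _ _ _ _ _ m12 (fun q p => F p.1 p.2 q.1 q.2)) => //.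
  exact: (measurableT_comp mF (measurable_fun_pair measurable_snd measurable_fst)).
- by move=> c d; exact: integral_ge0.
apply: eq_integral => c _; apply: eq_integral => d _.
by rewrite (@ge0_integral_prod_measure _ _ _ _ _ m1 m2 (fun a b => F a b c d)).
Qed.

(** * Slab energies and their averages *)

Section slab_energy.
Context {R : realType} (n : nat).
Local Notation V n := (n.-tuple (measurableTypeR R)).
Local Notation lam n := (lebesgue_tuple R n).
Local Notation mu := (@lebesgue_measure R).
Variable B : set (V n).
Hypothesis mB : measurable B.
Hypothesis finB : lam n B \is a fin_num.

Definition slab_mass h (w : V n) (r : R) : \bar R :=
  (\int[lam n]_x (\1_B x * window h r (tdot x w))%:E)%E.

Definition slab h w r : R := fine (slab_mass h w r).

Lemma measurable_EFin_indic d (T : measurableType d) (A : set T) :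
  measurable A -> measurable_fun setT (fun x => (\1_A x : R)%:E).
Proof. by move=> mA; apply/measurable_EFinP; exact: measurable_indic. Qed.

Lemma slab_mass_ge0 h w r : (0 <= slab_mass h w r)%E.
Proof. by apply: integral_ge0 => x _; rewrite lee_fin mulr_ge0// window_ge0. Qed.

Lemma measurable_slab_integrand d (T : measurableType d) h (f g : T -> V n) (k : T -> R) :
  measurable_fun setT f -> measurable_fun setT g -> measurable_fun setT k ->
  measurable_fun setT (fun t => \1_B (f t) * window h (k t) (tdot (f t) (g t))).
Proof.
move=> mf mg mk; apply: measurable_funM; first exact: measurable_indic_comp.
by apply: measurable_fun_window => //; exact: measurable_tdot.
Qed.

Lemma slab_mass_le h w r : (slab_mass h w r <= lam n B)%E.
Proof.
have -> : lam n B = (\int[lam n]_x (\1_B x : R)%:E)%E by rewrite integral_indic// setIT.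
apply: ge0_le_integral => //.
- by move=> x _; rewrite lee_fin mulr_ge0// window_ge0.
- by apply/measurable_EFinP; exact: measurable_slab_integrand.
- exact: measurable_EFin_indic.
- by move=> x _; rewrite lee_fin ler_piMr// window_le1.
Qed.

Lemma slab_massE h w r : slab_mass h w r = (slab h w r)%:E.
Proof.
rewrite /slab fineK// ge0_fin_numE ?slab_mass_ge0//.
by rewrite (le_lt_trans (slab_mass_le _ _ _))// -ge0_fin_numE.
Qed.

Lemma slab_ge0 h w r : 0 <= slab h w r.
Proof. exact/fine_ge0/slab_mass_ge0. Qed.

Lemma measurable_slab_mass d (T : measurableType d) h (f : T -> V n) (k : T -> R) :
  measurable_fun setT f -> measurable_fun setT k ->
  measurable_fun setT (fun t => slab_mass h (f t) (k t)).
Proof.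
move=> mf mk.
apply: (measurable_fun_fubini_tonelli_F (m2 := lam n)
  (fun p : T * V n => (\1_B p.2 * window h (k p.1) (tdot p.2 (f p.1)))%:E)).
  by apply/measurable_EFinP; apply: measurable_slab_integrand => //; exact: measurableT_comp.
by move=> p; rewrite lee_fin mulr_ge0// window_ge0.
Qed.

Lemma measurable_slab d (T : measurableType d) h (f : T -> V n) (k : T -> R) :
  measurable_fun setT f -> measurable_fun setT k ->
  measurable_fun setT (fun t => slab h (f t) (k t)).
Proof. by move=> mf mk; apply: measurableT_comp => //; exact: measurable_slab_mass. Qed.

Definition slab_energy h (w : V n) : \bar R :=
  (\int[mu]_r ((slab h w (r + h) - slab h w r) ^+ 2)%:E)%E.

Lemma slab_energy_ge0 h w : (0 <= slab_energy h w)%E.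
Proof. by apply: integral_ge0 => r _; rewrite lee_fin sqr_ge0. Qed.

Lemma measurable_slab_energy d (T : measurableType d) h (f : T -> V n) :
  measurable_fun setT f -> measurable_fun setT (fun t => slab_energy h (f t)).
Proof.
move=> mf.
apply: (measurable_fun_fubini_tonelli_F (m2 := mu)
  (fun p : T * measurableTypeR R => ((slab h (f p.1) (p.2 + h) - slab h (f p.1) p.2) ^+ 2)%:E)).
  apply/measurable_EFinP; apply: measurable_funX; apply: measurable_funB.
    by apply: measurable_slab; [exact: measurableT_comp|exact: measurable_funD].
  by apply: measurable_slab => //; exact: measurableT_comp.
by move=> p; rewrite lee_fin sqr_ge0.
Qed.

Definition slab_corr h e (w : V n) : \bar R :=
  (\int[mu]_r (slab h w r * slab h w (r + e))%:E)%E.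

Lemma slab_corr_ge0 h e w : (0 <= slab_corr h e w)%E.
Proof. by apply: integral_ge0 => r _;
    rewrite lee_fin (mulr_ge0 (slab_ge0 _ _ _) (slab_ge0 _ _ _)). Qed.

Lemma measurable_slab_corr d (T : measurableType d) h e (f : T -> V n) :
  measurable_fun setT f -> measurable_fun setT (fun t => slab_corr h e (f t)).
Proof.
move=> mf.
apply: (measurable_fun_fubini_tonelli_F (m2 := mu)
  (fun p : T * measurableTypeR R => (slab h (f p.1) p.2 * slab h (f p.1) (p.2 + e))%:E)).
  apply/measurable_EFinP; apply: measurable_funM.
    by apply: measurable_slab => //; exact: measurableT_comp.
  by apply: measurable_slab; [exact: measurableT_comp|exact: measurable_funD].
by move=> p; rewrite lee_fin (mulr_ge0 (slab_ge0 _ _ _) (slab_ge0 _ _ _)).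
Qed.

Lemma slab_energy_corr h w :
  (slab_energy h w + (slab_corr h h w + slab_corr h h w) =
   slab_corr h 0 w + slab_corr h 0 w)%E.
Proof.
have ms : measurable_fun setT (slab h w) by exact: measurable_slab.
have msh : measurable_fun setT (fun r : measurableTypeR R => slab h w (r + h)).
  by apply: measurable_slab => //; exact: measurable_funD.
have D (f g : measurableTypeR R -> R) : measurable_fun setT f -> measurable_fun setT g ->
    (forall r, 0 <= f r) -> (forall r, 0 <= g r) ->
    (\int[mu]_r (f r)%:E + \int[mu]_r (g r)%:E = \int[mu]_r (f r + g r)%:E)%E.
  move=> mf mg f0 g0; under [RHS]eq_integral do rewrite EFinD.
  by rewrite ge0_integralD//; [move=> r _; rewrite lee_fin|exact/measurable_EFinP
    |move=> r _; rewrite lee_fin|exact/measurable_EFinP].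
pose f1 (r : measurableTypeR R) := (slab h w (r + h) - slab h w r) ^+ 2.
pose f2 (r : measurableTypeR R) := slab h w r * slab h w (r + h).
pose f3 (r : measurableTypeR R) := slab h w (r + h) * slab h w (r + h).
pose f4 (r : measurableTypeR R) := slab h w r * slab h w r.
have c0 : slab_corr h 0 w = (\int[mu]_r (f4 r)%:E)%E.
  by apply: eq_integral => r _; rewrite addr0.
have mf1 : measurable_fun setT f1 by apply: measurable_funX; exact: measurable_funB.
have mf2 : measurable_fun setT f2 by exact: measurable_funM.
have mf3 : measurable_fun setT f3 by exact: measurable_funM.
have mf4 : measurable_fun setT f4 by exact: measurable_funM.
have f10 r : 0 <= f1 r by exact: sqr_ge0.
have f20 r : 0 <= f2 r by exact: (mulr_ge0 (slab_ge0 _ _ _) (slab_ge0 _ _ _)).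
have f30 r : 0 <= f3 r by exact: (mulr_ge0 (slab_ge0 _ _ _) (slab_ge0 _ _ _)).
have f40 r : 0 <= f4 r by exact: (mulr_ge0 (slab_ge0 _ _ _) (slab_ge0 _ _ _)).
have c1 : (\int[mu]_r (f3 r)%:E = \int[mu]_r (f4 r)%:E)%E.
  apply: (@ge0_integral_lebesgue_shift _ h (fun r => (f4 r)%:E)).
    exact/measurable_EFinP.
  by move=> r; rewrite lee_fin.
have fE r : f1 r + (f2 r + f2 r) = f3 r + f4 r by rewrite /f1 /f2 /f3 /f4; ring.
rewrite c0 -[X in _ = (X + _)%E]c1.
rewrite -[slab_energy h w]/(\int[mu]_r (f1 r)%:E)%E -[slab_corr h h w]/(\int[mu]_r (f2 r)%:E)%E.
clearbody f1 f2 f3 f4.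
have f220 r : 0 <= (f2 \+ f2) r by exact: addr_ge0.
rewrite (D f2 f2)// (D f3 f4)// (D f1 (f2 \+ f2))//; last exact: measurable_funD.
by apply: eq_integral => r _; congr (_%:E); exact: fE.
Qed.

End slab_energy.

Lemma ge0_integral_balance d (T : measurableType d) (R : realType)
    (m : {measure set T -> \bar R}) (e f g : T -> \bar R) :
  measurable_fun setT e -> measurable_fun setT f -> measurable_fun setT g ->
  (forall x, 0 <= e x)%E -> (forall x, 0 <= f x)%E -> (forall x, 0 <= g x)%E ->
  (forall x, e x + (f x + f x) = g x + g x)%E ->
  (\int[m]_x e x + (\int[m]_x f x + \int[m]_x f x) =
   \int[m]_x g x + \int[m]_x g x)%E.
Proof.
move=> me mf mg e0 f0 g0 efg; rewrite -!ge0_integralD//; last 2 first.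
- by move=> x _; exact: adde_ge0.
- exact: emeasurable_funD.
by apply: eq_integral => x _; exact: efg.
Qed.

Lemma ge0_balance_scale (R : realType) (k e u v : \bar R) :
  (0 <= k -> 0 <= e -> 0 <= u -> 0 <= v -> e + (u + u) = v + v ->
  k * e + (k * u + k * u) = k * v + k * v)%E.
Proof.
move=> k0 e0 u0 v0 euv; rewrite -(ge0_muleDr _ v0 v0) -euv.
by rewrite !ge0_muleDr// adde_ge0.
Qed.

Lemma ereal_balance_le (R : realType) (e t0 t : \bar R) (k : R) :
  (e + (t + t) = t0 + t0 -> t0 <= t + k%:E -> t \is a fin_num -> e <= (2 * k)%:E)%E.
Proof.
move=> ett tk /fineK tE; have := leeD tk tk; rewrite -ett -tE.
by case: e {ett} => [e||] //; rewrite ?leNye// -!EFinD !lee_fin => ?; lra.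
Qed.

Section averaged_energy.
Context {R : realType} (n : nat).
Local Notation V n := (n.-tuple (measurableTypeR R)).
Local Notation lam n := (lebesgue_tuple R n).
Local Notation mu := (@lebesgue_measure R).
Variable B : set (V n).
Hypothesis mB : measurable B.
Hypothesis finB : lam n B \is a fin_num.
Variable A : 'M[R]_(3, n).

Definition tuple_sub m (x y : V m) : V m := tuple_add x (tuple_opp y).

Lemma measurable_tuple_sub d (T : measurableType d) m (f g : T -> V m) :
  measurable_fun setT f -> measurable_fun setT g ->
  measurable_fun setT (fun x => tuple_sub (f x) (g x)).
Proof. by move=> mf mg; apply: measurable_tuple_add => //; exact: measurable_tuple_opp. Qed.

Lemma tdotBl m (x y z : V m) : tdot (tuple_sub x y) z = tdot x z - tdot y z.
Proof. by rewrite /tdot row_of_tupleD row_of_tupleN scalar_productBl. Qed.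

(* The contribution of the pair (x, y) to the correlation of S_h(r) and
   S_h(r + e), averaged over the directions in the image of the shell. *)
Definition pair_kernel h e (x y : V n) : \bar R :=
  ((\1_B x * \1_B y)%:E * \int[lam 3]_a
    ((\1_shell a)%:E * overlap h (tdot (tuple_mul A^T (tuple_sub y x)) a - e)))%E.

Let phi h e (a : V 3) (r : measurableTypeR R) (x y : V n) : R :=
  \1_shell a * ((\1_B x * window h r (tdot x (tuple_mul A a))) *
    (\1_B y * window h (r + e) (tdot y (tuple_mul A a)))).

Let phi_ge0 h e a r x y : 0 <= phi h e a r x y.
Proof. by rewrite /phi !mulr_ge0// window_ge0. Qed.

Let measurable_phi d (T : measurableType d) h e (a : T -> V 3) (r : T -> measurableTypeR R)
    (x y : T -> V n) :
  measurable_fun setT a -> measurable_fun setT r ->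
  measurable_fun setT x -> measurable_fun setT y ->
  measurable_fun setT (fun t => phi h e (a t) (r t) (x t) (y t)).
Proof.
move=> ma mr mx my; apply: measurable_funM.
  by apply: measurable_indic_comp => //; exact: measurable_shell.
have mA : measurable_fun setT (fun t => tuple_mul A (a t)) by exact: measurable_tuple_mul.
apply: measurable_funM; apply: measurable_slab_integrand => //.
exact: measurable_funD.
Qed.

Lemma slab_corr_integrand h e (a : V 3) r :
  (\int[lam n]_x \int[lam n]_y (phi h e a r x y)%:E =
   (\1_shell a)%:E * (slab B h (tuple_mul A a) r * slab B h (tuple_mul A a) (r + e))%:E)%E.
Proof.
rewrite EFinM -!slab_massE//.
set w := tuple_mul A a.
have ms r' : measurable_fun setT (fun x : V n => (\1_B x * window h r' (tdot x w))%:E).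
  by apply/measurable_EFinP; exact: measurable_slab_integrand.
have s0 r' (x : V n) : (0 <= (\1_B x * window h r' (tdot x w))%:E)%E.
  by rewrite lee_fin mulr_ge0// window_ge0.
have i0 : (0 <= (\1_shell a : R)%:E)%E by rewrite lee_fin.
transitivity (\int[lam n]_x (((\1_shell a)%:E * slab_mass B h w (r + e)) * (\1_B x * window h r
    (tdot x w))%:E))%E.
  apply: eq_integral => x _.
  transitivity (\int[lam n]_y (((\1_shell a)%:E * (\1_B x * window h r (tdot x w))%:E) *
     (\1_B y * window h (r + e) (tdot y w))%:E))%E.
    by apply: eq_integral => y _; rewrite -!EFinM -mulrA.
  rewrite ge0_integralZl//; last by apply: mule_ge0.
  by rewrite muleAC.
rewrite ge0_integralZl//; last by apply: mule_ge0 => //; exact: slab_mass_ge0.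
by rewrite -muleA; congr (_ * _)%E; rewrite muleC.
Qed.

Lemma integral_slab_corr h e :
  (\int[lam 3]_a ((\1_shell a)%:E * slab_corr B h e (tuple_mul A a)) =
   \int[lam n]_x \int[lam n]_y pair_kernel h e x y)%E.
Proof.
transitivity (\int[lam 3]_a \int[mu]_r \int[lam n]_x \int[lam n]_y (phi h e a r x y)%:E)%E.
  apply: eq_integral => a _.
  under [RHS]eq_integral do rewrite slab_corr_integrand.
  apply/esym/ge0_integralZl => //.
  - by apply/measurable_EFinP; apply: measurable_funM; apply: measurable_slab => //;
      exact: measurable_funD.
  - by move=> r _; rewrite lee_fin; exact: (mulr_ge0 (slab_ge0 _ _ _ _) (slab_ge0 _ _ _ _)).
rewrite (@ge0_integral_swap4 _ _ _ _ _ _ _ _ _ (lam 3) mu (lam n) (lam n)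
  (fun a r x y => (phi h e a r x y)%:E)); last 2 first.
- by apply/measurable_EFinP; apply: measurable_phi => //; exact: measurableT_comp.
- by move=> a r x y; rewrite lee_fin phi_ge0.
apply: eq_integral => x _; apply: eq_integral => y _.
have mo : measurable_fun setT (fun a : V 3 =>
    overlap h (tdot (tuple_mul A^T (tuple_sub y x)) a - e)).
  apply: (measurableT_comp (@measurable_overlap R h)); apply: measurable_funB => //.
  exact: measurable_tdot.
rewrite /pair_kernel -ge0_integralZl//; last 2 first.
- apply: emeasurable_funM => //.
  by apply: measurable_EFin_indic; exact: measurable_shell.
- by move=> a _; apply: mule_ge0; [rewrite lee_fin|exact: overlap_ge0].
apply: eq_integral => a _.
rewrite tdotC -tdot_tuple_mul tdotC tdotBl -integral_window2.
set w := tuple_mul A a.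
have mw : measurable_fun setT (fun r : measurableTypeR R =>
    (window h r (tdot x w) * window h (r + e) (tdot y w))%:E).
  apply/measurable_EFinP; apply: measurable_funM; apply: measurable_fun_window => //.
  exact: measurable_funD.
rewrite muleA -ge0_integralZl//; last by move=> r _; rewrite lee_fin mulr_ge0// window_ge0.
by apply: eq_integral => r _; rewrite -!EFinM /phi; congr (_%:E); ring.
Qed.

Let lshell : R := fine (lam 3 shell).

Let shell_fin : lam 3 shell = lshell%:E.
Proof.
rewrite /lshell fineK// ge0_fin_numE//.
apply: (@le_lt_trans _ _ (lam 3 (disc 3 4))).
  apply: le_measure; rewrite ?inE; [exact: measurable_shell|exact: measurable_disc|].
  exact: subDsetl.
by rewrite -ge0_fin_numE// lebesgue_disc_fin_num.
Qed.

Let lshell_ge0 : 0 <= lshell.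
Proof. exact: fine_ge0. Qed.

Let measurable_pair_integrand d (T : measurableType d) h e (f : T -> V n) (g : T -> V n)
    (a : T -> V 3) :
  measurable_fun setT f -> measurable_fun setT g -> measurable_fun setT a ->
  measurable_fun setT (fun t => (\1_shell (a t))%:E *
    overlap h (tdot (tuple_mul A^T (tuple_sub (g t) (f t))) (a t) - e))%E.
Proof.
move=> mf mg ma; apply: emeasurable_funM.
  by apply/measurable_EFinP; apply: measurable_indic_comp => //; exact: measurable_shell.
apply: (measurableT_comp (@measurable_overlap R h)); apply: measurable_funB => //.
by apply: measurable_tdot => //; apply: measurable_tuple_mul; exact: measurable_tuple_sub.
Qed.

Let pair_integrand_ge0 h e (x y : V n) a :
  (0 <= (\1_shell a)%:E * overlap h (tdot (tuple_mul A^T (tuple_sub y x)) a - e))%E.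
Proof. by apply: mule_ge0; [rewrite lee_fin|exact: overlap_ge0]. Qed.

Lemma measurable_pair_kernel d (T : measurableType d) h e (f g : T -> V n) :
  measurable_fun setT f -> measurable_fun setT g ->
  measurable_fun setT (fun t => pair_kernel h e (f t) (g t)).
Proof.
move=> mf mg; apply: emeasurable_funM.
  by apply/measurable_EFinP; apply: measurable_funM; exact: measurable_indic_comp.
apply: (@ge0_measurable_integral _ _ _ _ _ (lam 3) (fun t a => (\1_shell a)%:E *
    overlap h (tdot (tuple_mul A^T (tuple_sub (g t) (f t))) a - e))%E).
  by apply: measurable_pair_integrand => //; exact: measurableT_comp.
by move=> t a; exact: pair_integrand_ge0.
Qed.

Lemma pair_kernel_ge0 h e x y : (0 <= pair_kernel h e x y)%E.
Proof.
apply: mule_ge0; first by rewrite lee_fin mulr_ge0.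
by apply: integral_ge0 => a _; exact: pair_integrand_ge0.
Qed.

Lemma pair_kernel_le h e x y : 0 <= h ->
  (pair_kernel h e x y <= (\1_B x * \1_B y * (h * lshell))%:E)%E.
Proof.
move=> h0; rewrite EFinM /pair_kernel; apply: lee_pmul => //.
  by apply: integral_ge0 => a _; exact: pair_integrand_ge0.
apply: (@le_trans _ _ (\int[lam 3]_a (h%:E * (\1_shell a)%:E))%E); last first.
  rewrite ge0_integralZl//; last by apply: measurable_EFin_indic; exact: measurable_shell.
  rewrite integral_indic//; last exact: measurable_shell.
  by rewrite setIT EFinM -shell_fin.
apply: ge0_le_integral => //.
- exact: (@measurable_pair_integrand _ _ h e (cst x) (cst y) id).
- by apply: emeasurable_funM => //; apply: measurable_EFin_indic; exact: measurable_shell.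
- by move=> a _; rewrite muleC; apply: lee_pmul => //; [exact: overlap_ge0|exact: overlap_le].
Qed.

Definition near_pair h (x y : V n) : R :=
  (tdot (tuple_mul A^T (tuple_sub y x)) (tuple_mul A^T (tuple_sub y x)) < (h *+ 2) ^+ 2)%R%:R.

Lemma measurable_near_pair d (T : measurableType d) h (f g : T -> V n) :
  measurable_fun setT f -> measurable_fun setT g ->
  measurable_fun setT (fun t => near_pair h (f t) (g t)).
Proof.
move=> mf mg; rewrite [X in measurable_fun _ X](_ : _ = (fun b : bool => b%:R : R) \o
  (fun t => tdot (tuple_mul A^T (tuple_sub (g t) (f t))) (tuple_mul A^T (tuple_sub (g t)
      (f t))) < (h *+ 2) ^+ 2)%R)//.
apply: measurableT_comp; first by [].
apply: measurable_fun_ltr => //.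
by apply: measurable_tdot; apply: measurable_tuple_mul; exact: measurable_tuple_sub.
Qed.

Lemma pair_kernel_compare h x y : 0 < h ->
  (pair_kernel h 0 x y <= pair_kernel h h x y + (\1_B x * \1_B y * near_pair h x y *
      (h * lshell))%:E)%E.
Proof.
move=> h0; rewrite /near_pair; have [far|near] := leP ((h *+ 2) ^+ 2) _.
  rewrite mulr0 mul0r adde0 /pair_kernel.
  by under eq_integral do rewrite subr0; rewrite shell_overlap_shift.
rewrite mulr1; apply: (le_trans (pair_kernel_le _ _ _ (ltW h0))).
by rewrite leeDr// pair_kernel_ge0.
Qed.

Variable C : R.
Hypothesis near_volume_le : forall (h : R) (x : V n), 0 < h ->
  (\int[lam n]_y (\1_B y * near_pair h x y)%:E <= (C * h ^+ 3)%:E)%E.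

Lemma averaged_slab_energy (h : R) : 0 < h ->
  (\int[lam 3]_a ((\1_shell a)%:E * slab_energy B h (tuple_mul A a)) <=
   (2 * (fine (lam n B) * (lshell * C)) * h ^+ 4)%:E)%E.
Proof.
move=> h0; have h0' := ltW h0.
have mT e : measurable_fun setT (fun a : V 3 => (\1_shell a)%:E * slab_corr B h e
    (tuple_mul A a))%E.
  apply: emeasurable_funM; first by apply: measurable_EFin_indic; exact: measurable_shell.
  by apply: measurable_slab_corr => //; exact: measurable_tuple_mul.
have T0 e (a : V 3) : (0 <= (\1_shell a)%:E * slab_corr B h e (tuple_mul A a))%E.
  by apply: mule_ge0; [rewrite lee_fin|exact: slab_corr_ge0].
have mE : measurable_fun setT (fun a : V 3 => (\1_shell a)%:E * slab_energy B h
    (tuple_mul A a))%E.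
  apply: emeasurable_funM; first by apply: measurable_EFin_indic; exact: measurable_shell.
  by apply: measurable_slab_energy => //; exact: measurable_tuple_mul.
have E0 (a : V 3) : (0 <= (\1_shell a)%:E * slab_energy B h (tuple_mul A a))%E.
  by apply: mule_ge0; [rewrite lee_fin|exact: slab_energy_ge0].
pose T e : \bar R := (\int[lam 3]_a ((\1_shell a)%:E * slab_corr B h e (tuple_mul A a)))%E.
pose E : \bar R := (\int[lam 3]_a ((\1_shell a)%:E * slab_energy B h (tuple_mul A a)))%E.
have ETT : (E + (T h + T h) = T 0%R + T 0%R)%E.
  apply: ge0_integral_balance => // a.
  by apply: ge0_balance_scale; [rewrite lee_fin|exact: slab_energy_ge0|exact: slab_corr_ge0
    |exact: slab_corr_ge0|exact: slab_energy_corr].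
set K := (2 * _ * _)%R.
suff [] : (T 0%R <= T h + (K / 2)%:E)%E /\ T h \is a fin_num.
  by move=> T0h Tfin; rewrite (_ : K = 2 * (K / 2)); [exact: (ereal_balance_le ETT)|field].
have mk e x : measurable_fun setT (fun y => pair_kernel h e x y).
  exact: measurable_pair_kernel.
have mk2 e : measurable_fun setT (fun z : V n * V n => pair_kernel h e z.1 z.2).
  exact: measurable_pair_kernel.
have BB0 (x y : V n) : 0 <= \1_B x * \1_B y * (h * lshell) by rewrite !mulr_ge0.
pose g (x y : V n) := \1_B x * \1_B y * near_pair h x y * (h * lshell).
have g0 x y : 0 <= g x y by rewrite !mulr_ge0// ler0n.
have mg d (U : measurableType d) (f1 f2 : U -> V n) :
    measurable_fun setT f1 -> measurable_fun setT f2 ->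
    measurable_fun setT (fun u => (g (f1 u) (f2 u))%:E).
  move=> m1 m2; apply/measurable_EFinP; apply: measurable_funM => //.
  apply: measurable_funM; last exact: measurable_near_pair.
  by apply: measurable_funM; exact: measurable_indic_comp.
have lBE : (\int[lam n]_x (\1_B x : R)%:E)%E = (fine (lam n B))%:E.
  by rewrite integral_indic// setIT fineK.
have mB1 : measurable_fun setT (fun x : V n => (\1_B x : R)%:E) by exact: measurable_EFin_indic.
have mkT e : measurable_fun setT (fun x : V n => \int[lam n]_y pair_kernel h e x y)%E.
  by apply: (@ge0_measurable_integral _ _ _ _ _ (lam n) (pair_kernel h e)) => // x y;
      exact: pair_kernel_ge0.
have mgT : measurable_fun setT (fun x : V n => \int[lam n]_y (g x y)%:E)%E.
  apply: (@ge0_measurable_integral _ _ _ _ _ (lam n) (fun x y => (g x y)%:E)); first exact: mg.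
  by move=> x y; rewrite lee_fin.
have kT0 e (x : V n) : (0 <= \int[lam n]_y pair_kernel h e x y)%E.
  by apply: integral_ge0 => y _; exact: pair_kernel_ge0.
have gT0 (x : V n) : (0 <= \int[lam n]_y (g x y)%:E)%E.
  by apply: integral_ge0 => y _; rewrite lee_fin.
split.
  rewrite /T (integral_slab_corr h 0) (integral_slab_corr h h).
  apply: (@le_trans _ _ (\int[lam n]_x (\int[lam n]_y pair_kernel h h x y + \int[lam n]_y
      (g x y)%:E))%E).
    apply: ge0_le_integral => //.
      exact: emeasurable_funD.
    move=> x _; rewrite -ge0_integralD//; last 3 first.
    - by move=> y _; exact: pair_kernel_ge0.
    - by move=> y _; rewrite lee_fin.
    - exact: (mg _ _ (cst x) id).
    apply: ge0_le_integral => //.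
    - by move=> y _; exact: pair_kernel_ge0.
    - by apply: emeasurable_funD => //; exact: (mg _ _ (cst x) id).
    - by move=> y _; exact: pair_kernel_compare.
  rewrite ge0_integralD// leeD2l//.
  apply: (@le_trans _ _ (\int[lam n]_x ((h * lshell * (C * h ^+ 3))%:E * (\1_B x)%:E))%E).
    apply: ge0_le_integral => //.
      exact: emeasurable_funM.
    move=> x _.
    have -> : (\int[lam n]_y (g x y)%:E = (\1_B x * (h * lshell))%:E * \int[lam n]_y
        (\1_B y * near_pair h x y)%:E)%E.
      rewrite -ge0_integralZl//.
      - by apply: eq_integral => y _; rewrite -EFinM /g; congr (_%:E); ring.
      - apply/measurable_EFinP; apply: measurable_funM; first exact: measurable_indic.
        exact: (measurable_near_pair h (f := cst x) (g := id)).
      - by move=> y _; rewrite lee_fin mulr_ge0// ler0n.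
      - by rewrite lee_fin !mulr_ge0.
    rewrite -EFinM [leRHS](_ : _ = ((\1_B x * (h * lshell))%:E * (C * h ^+ 3)%:E)%E).
      by apply: lee_wpmul2l; [rewrite lee_fin !mulr_ge0|exact: near_volume_le].
    by rewrite -EFinM; congr (_%:E); ring.
  have near0 := near_volume_le [tuple 0 | _ < n] h0.
  have Ch0 : 0 <= C * h ^+ 3.
    rewrite -lee_fin (le_trans _ near0)//; apply: integral_ge0 => y _.
    by rewrite lee_fin mulr_ge0// ler0n.
  rewrite ge0_integralZl//; last by rewrite lee_fin;
      exact: mulr_ge0 (mulr_ge0 h0' lshell_ge0) Ch0.
  by rewrite lBE -EFinM lee_fin /K le_eqVlt; apply/orP; left; apply/eqP; field.
rewrite /T integral_slab_corr ge0_fin_numE; last by apply: integral_ge0 => x _.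
apply: (@le_lt_trans _ _ (\int[lam n]_x (((fine (lam n B)) * (h * lshell))%:E * (\1_B x)%:E))%E).
  apply: ge0_le_integral => //.
    exact: emeasurable_funM.
  move=> x _; apply: (@le_trans _ _ (\int[lam n]_y ((\1_B x * (h * lshell))%:E * (\1_B y)%:E))%E).
    apply: ge0_le_integral => //.
    - by move=> y _; exact: pair_kernel_ge0.
    - exact: emeasurable_funM.
    - move=> y _; rewrite (le_trans (pair_kernel_le _ _ _ h0'))// -EFinM lee_fin.
      by rewrite mulrAC.
  rewrite ge0_integralZl//; last by rewrite lee_fin !mulr_ge0.
  by rewrite lBE -!EFinM lee_fin le_eqVlt; apply/orP; left; apply/eqP; ring.
rewrite ge0_integralZl//; last by rewrite lee_fin !mulr_ge0// fine_ge0.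
by rewrite lBE -EFinM ltry.
Qed.

End averaged_energy.

Lemma integral_EFin_indic d (T : measurableType d) (R : realType)
    (mu : {measure set T -> \bar R}) (A : set T) :
  measurable A -> (\int[mu]_x (\1_A x)%:E = mu A)%E.
Proof. by move=> mA; rewrite integral_indic// setIT. Qed.

Section near_volume.
Context {R : realType} (m : nat).
Let n := m.+3.
Local Notation V n := (n.-tuple (measurableTypeR R)).
Local Notation lam n := (lebesgue_tuple R n).
Variable B : set (V n).
Hypothesis mB : measurable B.
Variable r : R.
Hypothesis r0 : 0 <= r.
Hypothesis BC : B `<=` cube n r.

(* The linear map a |-> a_0 w + a_1 e_1 + a_2 e_2. *)
Definition frame3 (w : V n) : 'M[R]_(3, n) :=
  \matrix_(i, j) if i == 0 :> nat then tnth w j else (i == j :> nat)%:R.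

Let shear (w : V n) : 'M[R]_n :=
  \matrix_(i, j) if j == 0 :> nat then tnth w i else (i == j)%:R.

Let shear_unit (w : V n) : tnth w ord0 != 0 -> shear w \in unitmx.
Proof.
move=> w0; rewrite unitmxE det_trig; last first.
  apply/is_trig_mxP => i j ij; rewrite mxE ifN; last by case: (j : nat) ij.
  by rewrite (_ : i == j = false)//; apply/eqP => e; move: ij; rewrite e ltnn.
rewrite unitfE; apply/prodf_neq0 => i _; rewrite mxE eqxx.
case: ifPn => [/eqP i0|_]; last exact: oner_neq0.
by rewrite (_ : i = ord0)//; exact/val_inj.
Qed.

Let frame3_shear (w z : V n) (i : 'I_3) (j : 'I_n) : i = j :> nat ->
  tnth (tuple_mul (frame3 w)^T z) i = tnth (tuple_mul (shear w) z) j.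
Proof.
move=> ij; rewrite !tnth_mktuple !mxE; apply: eq_bigr => k _; rewrite !mxE ij.
by case: ifP => // _; rewrite eq_sym.
Qed.

Let shear_id (w z : V n) (j : 'I_n) : j != 0 :> nat ->
  tnth (tuple_mul (shear w) z) j = tnth z j.
Proof.
move=> j0; rewrite tnth_mktuple mxE (bigD1 j)//= !mxE (negbTE j0) eqxx mulr1.
rewrite big1 ?addr0// => i ij; rewrite !mxE (negbTE j0).
by rewrite (negbTE ij) mulr0.
Qed.

Lemma near_volume (w : V n) : tnth w ord0 != 0 -> exists C : R,
  forall (h : R) (x : V n), 0 < h ->
  (\int[lam n]_y (\1_B y * near_pair (frame3 w) h x y)%:E <= (C * h ^+ 3)%:E)%E.
Proof.
move=> w0; have [c c0 Hc] := lebesgue_tuple_mul (shear_unit w0).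
exists (c * (4 ^+ 3 * (r *+ 2) ^+ m)) => h x h0.
pose y0 := tuple_mul (shear w) x.
pose a : V n := [tuple if (i < 3)%N then tnth y0 i - h *+ 2 else - r | i < n].
pose b : V n := [tuple if (i < 3)%N then tnth y0 i + h *+ 2 else r | i < n].
pose Box := [set t : V n | forall i, tnth a i <= tnth t i <= tnth b i].
have mBox : measurable Box by exact: measurable_tuple_box.
have h2 : 0 <= h *+ 2 by rewrite mulrn_wge0// ltW.
have -> : ((c * (4 ^+ 3 * (r *+ 2) ^+ m)) * h ^+ 3)%:E = lam n (tuple_mul (shear w) @^-1` Box).
  rewrite Hc// /Box lebesgue_tuple_box; last first.
    move=> i; rewrite !tnth_mktuple; case: ifP => _.
      by rewrite lerBlDr -addrA lerDl addr_ge0.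
    by rewrite (le_trans _ r0)// oppr_le0.
  rewrite -EFinM; congr (_%:E); rewrite !big_ord_recl /= !tnth_mktuple/=.
  under eq_bigr do rewrite !tnth_mktuple/= opprK -mulr2n.
  rewrite prodr_const card_ord.
  have E (u v : R) : (u + v) - (u - v) = v * 2 by ring.
  by rewrite !E -mulr_natr; ring.
have mpre : measurable (tuple_mul (shear w) @^-1` Box).
  by apply: measurable_preimageT => //; exact: measurable_tuple_mul.
have -> : lam n (tuple_mul (shear w) @^-1` Box) =
    (\int[lam n]_y (\1_(tuple_mul (shear w) @^-1` Box) y : R)%:E)%E.
  exact/esym/integral_EFin_indic.
have H y : B y -> tdot (tuple_mul (frame3 w)^T (tuple_sub y x))
    (tuple_mul (frame3 w)^T (tuple_sub y x)) < (h *+ 2) ^+ 2 -> Box (tuple_mul (shear w) y).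
  move=> By /ltW/(cube_tdot h2) near i; rewrite [tnth a i]tnth_mktuple [tnth b i]tnth_mktuple.
  case: ifPn => i3; last by rewrite shear_id; [exact: BC|case: (i : nat) i3].
  have := near (Ordinal i3); rewrite (@frame3_shear w _ (Ordinal i3) i)//.
  have -> : tnth (tuple_mul (shear w) (tuple_sub y x)) i =
      tnth (tuple_mul (shear w) y) i - tnth y0 i.
    rewrite !tnth_mktuple row_of_tupleD row_of_tupleN mulmxBl !mxE.
    by [].
  by move=> /andP[h1 h3]; apply/andP; split; lra.
apply: ge0_le_integral => //.
- by move=> y _; rewrite lee_fin mulr_ge0// ler0n.
- apply/measurable_EFinP; apply: measurable_funM; first exact: measurable_indic.
  exact: (measurable_near_pair (frame3 w) h (f := cst x) (g := id)).
- exact: measurable_EFin_indic.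
- move=> y _; rewrite lee_fin /near_pair indicE.
  have [/set_mem By|_] := boolP (y \in B); last by rewrite mul0r.
  rewrite mul1r; case: ltP => near; last by [].
  by rewrite indicE mem_set//; exact: H.
Qed.

End near_volume.

(** * Exceptional directions *)

Section fatou_corollaries.
Context d (T : measurableType d) (R : realType).
Variable mu : {measure set T -> \bar R}.
Local Open Scope ereal_scope.

Lemma limn_einf_ltP (u : (\bar R)^nat) (C : \bar R) : limn_einf u < C ->
  forall N, exists2 k, (N <= k)%N & u k < C.
Proof.
move=> uC N; have : einfs u N < C.
  apply: le_lt_trans uC; rewrite limn_einf_lim.
  rewrite (cvg_lim _ (@cvg_einfs_sup _ u))//.
  by apply: ereal_sup_ubound; exists N.
by move=> /ereal_inf_lt[_ [k /= Nk <-] ukC]; exists k.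
Qed.

Lemma limn_einf_le (u : (\bar R)^nat) (C : \bar R) : (forall k, u k <= C) -> limn_einf u <= C.
Proof.
move=> uC; rewrite leNgt; apply/negP => Cu.
have : C < ereal_sup (range (einfs u)).
  by rewrite -(cvg_lim _ (@cvg_einfs_sup _ u))// -limn_einf_lim.
move=> /ereal_sup_gt[_ [N _ <-]]; rewrite ltNge => /negP; apply.
by apply: (@le_trans _ _ (u N)) => //; apply: ereal_inf_lbound; exists N => /=.
Qed.

Lemma measurable_fun_limn_einf (f : (T -> \bar R)^nat) :
  (forall k, measurable_fun setT (f k)) -> measurable_fun setT (fun x => limn_einf (f^~ x)).
Proof.
move=> mf; rewrite [X in measurable_fun _ X](_ : _ = fun x => - limn_esup (fun k => - f k x));
    last first.
  by apply/funext => x.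
apply: measurableT_comp => //.
apply: (@measurable_fun_limn_esup _ _ _ _ (fun k x => - f k x)) => k.
exact: measurableT_comp.
Qed.

Lemma measure_eq_pinfty (f : T -> \bar R) : measurable_fun setT f -> (forall x, 0 <= f x) ->
  \int[mu]_x f x < +oo -> mu [set x | f x = +oo] = 0.
Proof.
move=> mf f0 foo; have fi : mu.-integrable setT f.
  by apply/integrableP; split => //; under eq_integral do rewrite gee0_abs//.
have [N [mN N0 NS]] := integrable_ae measurableT fi.
apply/eqP; rewrite eq_le measure_ge0 andbT -N0; apply: le_measure; rewrite ?inE//.
  rewrite (_ : mkset _ = f @^-1` [set +oo])//.
  by apply: measurable_preimageT => //; exact: emeasurable_set1.
by move=> x /= fx; apply: NS => /= /(_ I); rewrite fx.
Qed.

Lemma fatou_bounded (f : (T -> \bar R)^nat) (K : R) :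
  (forall k, measurable_fun setT (f k)) -> (forall k x, 0 <= f k x) ->
  (forall k, \int[mu]_x f k x <= K%:E) ->
  mu [set x | limn_einf (f^~ x) = +oo] = 0.
Proof.
move=> mf f0 fK; apply: measure_eq_pinfty.
- exact: measurable_fun_limn_einf.
- move=> x; rewrite leNgt; apply/negP => /limn_einf_ltP/(_ 0%N)[k _].
  by rewrite ltNge f0.
- apply: (@le_lt_trans _ _ K%:E); last exact: ltry.
  by apply: le_trans (fatou _ _ _ _) _ => //; exact: limn_einf_le.
Qed.

Lemma measure_pos_of_integral0 (f : T -> \bar R) : measurable_fun setT f ->
    (forall x, 0 <= f x) ->
  \int[mu]_x f x = 0 -> forall A, measurable A -> 0 < mu A -> exists2 x, A x & f x = 0.
Proof.
move=> mf f0 If A mA A0; apply: contrapT => H.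
have : ae_eq mu setT f (cst 0).
  by apply/ae_eq_integral_abs => //; under eq_integral do rewrite gee0_abs//.
move=> [N [mN N0 NS]].
have : mu A <= mu N.
  apply: le_measure; rewrite ?inE// => x Ax; apply: NS => /= fx.
  by apply: H; exists x => //; exact: fx.
by rewrite N0 leNgt A0.
Qed.

End fatou_corollaries.

Lemma pmule_eq0 (R : realType) (c : R) (x : \bar R) : 0 < c -> (c%:E * x = 0)%E -> x = 0%E.
Proof. by move=> c0 /eqP; rewrite mule_eq0 eqe gt_eqF//= => /eqP. Qed.

Section high_energy_directions.
Context {R : realType} (m : nat).
Let n := m.+3.
Local Notation V n := (n.-tuple (measurableTypeR R)).
Local Notation lam n := (lebesgue_tuple R n).
Variable B : set (V n).
Hypothesis mB : measurable B.
Variable r : R.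
Hypothesis r0 : 0 <= r.
Hypothesis BC : B `<=` cube n r.

Definition mesh (k : nat) : R := k.+2%:R^-1.

Lemma mesh_gt0 k : 0 < mesh k.
Proof. by rewrite invr_gt0. Qed.

Definition energy_rate (k : nat) (w : V n) : \bar R :=
  (((mesh k ^+ 4)^-1)%:E * slab_energy B (mesh k) w)%E.

(* The exceptional directions: those along which the L^2 norms of the
   difference quotients tend to infinity. *)
Definition high_energy : set (V n) := [set w | limn_einf (energy_rate^~ w) = +oo%E].

Lemma bounded_fin_num : lam n B \is a fin_num.
Proof.
rewrite ge0_fin_numE//; apply: (@le_lt_trans _ _ (lam n (cube n r))).
  by apply: le_measure; rewrite ?inE//; exact: measurable_cube.
by rewrite lebesgue_tuple_cube// ltry.
Qed.

Lemma measurable_energy_rate d (T : measurableType d) k (f : T -> V n) :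
  measurable_fun setT f -> measurable_fun setT (fun t => energy_rate k (f t)).
Proof.
move=> mf; apply: emeasurable_funM => //; exact: measurable_slab_energy.
Qed.

Lemma measurable_high_energy : measurable high_energy.
Proof.
rewrite (_ : high_energy = (fun w => limn_einf (energy_rate^~ w)) @^-1` [set +oo%E])//.
apply: measurable_preimageT; last exact: emeasurable_set1.
by apply: measurable_fun_limn_einf => k; exact: measurable_energy_rate.
Qed.

Lemma shell_high_energy_null (w : V n) : tnth w ord0 != 0 ->
  lam 3 (shell `&` (tuple_mul (frame3 w) @^-1` high_energy)) = 0%E.
Proof.
move=> w0; have [C HC] := near_volume mB r0 BC w0.
pose f k (a : V 3) := ((\1_shell a)%:E * energy_rate k (tuple_mul (frame3 w) a))%E.
have mw : measurable_fun setT (@tuple_mul R 3 n (frame3 w)) by exact: measurable_tuple_mul.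
have mf k : measurable_fun setT (f k).
  apply: emeasurable_funM; last exact: measurable_energy_rate.
  by apply: measurable_EFin_indic; exact: measurable_shell.
have f0 k a : (0 <= f k a)%E.
  apply: mule_ge0; first by rewrite lee_fin.
  by apply: mule_ge0; [rewrite lee_fin invr_ge0 exprn_ge0// ltW// mesh_gt0|exact:
      slab_energy_ge0].
pose K := 2 * (fine (lam n B) * (fine (lam 3 shell) * C)).
have fK k : (\int[lam 3]_a f k a <= K%:E)%E.
  have s4 : 0 < mesh k ^+ 4 by rewrite exprn_gt0// mesh_gt0.
  have -> : (\int[lam 3]_a f k a = ((mesh k ^+ 4)^-1)%:E *
      \int[lam 3]_a ((\1_shell a)%:E * slab_energy B (mesh k) (tuple_mul (frame3 w) a)))%E.
    rewrite -ge0_integralZl//.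
    - by apply: eq_integral => a _; rewrite /f /energy_rate muleCA.
    - apply: emeasurable_funM; first by apply: measurable_EFin_indic; exact: measurable_shell.
      exact: measurable_slab_energy.
    - by move=> a _; apply: mule_ge0; [rewrite lee_fin|exact: slab_energy_ge0].
    - by rewrite lee_fin invr_ge0 ltW.
  rewrite lee_pdivrMl//.
  apply: le_trans (averaged_slab_energy mB bounded_fin_num HC (mesh_gt0 k)) _.
  by rewrite -EFinM lee_fin mulrC.
have N0 := fatou_bounded mf f0 fK.
apply/eqP; rewrite eq_le measure_ge0 andbT -N0; apply: le_measure; rewrite ?inE.
- apply: measurableI; first exact: measurable_shell.
  by apply: measurable_preimageT => //; exact: measurable_high_energy.
- rewrite (_ : mkset _ = (fun a => limn_einf (f^~ a)) @^-1` [set +oo%E])//.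
  apply: measurable_preimageT; last exact: emeasurable_set1.
  exact: measurable_fun_limn_einf.
- move=> a [sa ha] /=; rewrite -ha; congr limn_einf; apply/funext => k.
  by rewrite /f indicE mem_set// mul1e.
Qed.

Lemma measurable_frame3_mul d (T : measurableType d) (f : T -> V n) (g : T -> V 3) :
  measurable_fun setT f -> measurable_fun setT g ->
  measurable_fun setT (fun t => tuple_mul (frame3 (f t)) (g t)).
Proof.
move=> /measurable_fun_tnthP mf /measurable_fun_tnthP mg; apply/measurable_fun_tnthP => j.
rewrite [X in measurable_fun _ X](_ : _ = fun t => \sum_i
  (tnth (g t) i : R) * (if i == 0 :> nat then tnth (f t) j else (i == j :> nat)%:R)); last first.
  by apply/funext => t; rewrite /= tnth_mktuple mxE; apply: eq_bigr => i _; rewrite !mxE.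
apply: measurable_sum => i; apply: measurable_funM; first exact: mg.
by case: (i == 0 :> nat); [exact: mf|exact: measurable_cst].
Qed.

Lemma hyperplane0_null : lam n [set w : V n | tnth w ord0 = 0] = 0%E.
Proof.
rewrite /= /cons_measure /pushforward.
rewrite (_ : _ @^-1` _ = [set (0 : measurableTypeR R)] `*` setT); last first.
  by apply/seteqP; split => [[x t]/=|[x t] [/= h _]]; rewrite tnth0//; split.
rewrite product_measure1E//.
exact: (etrans (congr1 (fun z => z * _)%E (lebesgue_measure_set1 (0 : R))) (mul0e _)).
Qed.

Lemma shell_pos : (0 < lam 3 (shell `&` [set a : V 3 | (tnth a ord0 : R) != 0%R]))%E.
Proof.
pose lo : V 3 := [tuple if i == 0 :> nat then 6 / 5 else 0 | i < 3].
pose hi : V 3 := [tuple if i == 0 :> nat then 7 / 5 else 1 / 10 | i < 3].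
have mbox := measurable_tuple_box lo hi.
apply: (@lt_le_trans _ _ (lam 3 [set t : V 3 | forall i, tnth lo i <= tnth t i <= tnth hi i])).
  rewrite lebesgue_tuple_box; last by move=> i; rewrite !tnth_mktuple; case: ifP => _; lra.
  by rewrite lte_fin; apply: prodr_gt0 => i _; rewrite !tnth_mktuple; case: ifP => _; lra.
apply: le_measure; rewrite ?inE//.
  apply: measurableI; first exact: measurable_shell.
  rewrite (_ : mkset _ = (fun a : V 3 => tnth a ord0) @^-1` (~` [set (0 : R)])).
    apply: measurable_preimageT; first exact: measurable_tnth.
    by apply: measurableC; exact: measurable_set1.
  by apply/seteqP; split => a /= /eqP.
move=> t /= h.
have := h ord0; have := h (lift ord0 ord0); have := h (lift ord0 (lift ord0 ord0)).
rewrite !tnth_mktuple/= => /andP[a1 a2] /andP[b1 b2] /andP[c1 c2].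
have tE : tdot t t = tnth t ord0 * tnth t ord0 + (tnth t (lift ord0 ord0) * tnth t
    (lift ord0 ord0)
   + tnth t (lift ord0 (lift ord0 ord0)) * tnth t (lift ord0 (lift ord0 ord0))).
  by rewrite tdotE !big_ord_recl big_ord0 addr0.
split; last by rewrite gt_eqF//; lra.
split; rewrite /disc/= tE; first by nra.
by apply/negP; rewrite -ltNge; nra.
Qed.

Lemma frame3_affine (w : V n) (a : V 3) :
  tuple_mul (frame3 w) a =
  tuple_add (tuple_mul (tnth a ord0)%:M w) (tuple_mul (frame3 [tuple 0 | _ < n]) a).
Proof.
apply: (can_inj (@row_of_tupleK R n)); rewrite row_of_tupleD !tuple_of_rowK mul_mx_scalar.
apply/rowP => j; rewrite !mxE !big_ord_recl/= !mxE/= tnth_mktuple mulr0 add0r.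
by rewrite !big_ord0.
Qed.

Lemma lebesgue_tuple_shift (v : V n) (E : set (V n)) : measurable E ->
  lam n ((fun t => tuple_add t v) @^-1` E) = lam n E.
Proof.
move=> mE.
have mv : measurable_fun setT (fun t : V n => tuple_add t v) by exact: measurable_tuple_add.
rewrite -(integral_EFin_indic _ (measurable_preimageT mv mE)) -(integral_EFin_indic _ mE).
apply: (@ge0_integral_lebesgue_tuple_shift _ n v (fun x => (\1_E x)%:E)).
  exact: measurable_EFin_indic.
by move=> x; rewrite lee_fin.
Qed.

(* For fixed a, w |-> a_0 w + a_1 e_1 + a_2 e_2 is an affine bijection, so a
   single good a suffices. *)
Lemma high_energy_null : lam n high_energy = 0%E.
Proof.
have mH := measurable_high_energy.
pose Z := [set w : V n | (tnth w ord0 : R) != 0%R].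
have mZ : measurable Z.
  rewrite (_ : Z = (fun a : V n => tnth a ord0) @^-1` (~` [set (0 : R)])).
    apply: measurable_preimageT; first exact: measurable_tnth.
    by apply: measurableC; exact: measurable_set1.
  by apply/seteqP; split => a /= /eqP.
pose phi (w : V n) (a : V 3) : R := \1_Z w * (\1_shell a * \1_high_energy (tuple_mul
    (frame3 w) a)).
have phi0 w a : 0 <= phi w a by rewrite !mulr_ge0.
have mphi : measurable_fun setT (fun z : V n * V 3 => (phi z.1 z.2)%:E).
  apply/measurable_EFinP; apply: measurable_funM; first exact: measurable_indic_comp.
  apply: measurable_funM; first by apply: measurable_indic_comp => //; exact: measurable_shell.
  by apply: measurable_indic_comp => //; exact: measurable_frame3_mul.
have mfa (a : V 3) : measurable_fun setT (fun w : V n => tuple_mul (frame3 w) a).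
  exact: (measurable_frame3_mul (f := id) (g := cst a)).
have mfw (w : V n) : measurable_fun setT (tuple_mul (frame3 w)) by exact: measurable_tuple_mul.
have phiE (w : V n) (a : V 3) : phi w a =
    \1_Z w * \1_(shell `&` (tuple_mul (frame3 w) @^-1` high_energy)) a.
  by rewrite indicI.
have I0 : (\int[lam n]_w \int[lam 3]_a (phi w a)%:E = 0)%E.
  apply: integral0_eq => w _.
  have [w0|/negP w0] := boolP ((tnth w ord0 : R) == 0).
    apply: integral0_eq => a _; rewrite /phi indicE memNset ?mul0r//.
    by rewrite /Z/= w0.
  under eq_integral do rewrite phiE EFinM.
  rewrite ge0_integralZl//.
  - rewrite integral_EFin_indic; last first.
      apply: measurableI; first exact: measurable_shell.
      exact: measurable_preimageT.
    have Lw := shell_high_energy_null (introN idP w0).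
    by apply: (etrans (congr1 (fun z => _ * z)%E Lw)); exact: mule0.
  - apply: measurable_EFin_indic; apply: measurableI; first exact: measurable_shell.
    exact: measurable_preimageT.
have J0 : (\int[lam 3]_a \int[lam n]_w (phi w a)%:E = 0)%E.
  by rewrite -I0; apply/esym; apply: (@ge0_integral_swap _ _ _ _ _ (lam n) (lam 3) (fun w a =>
      (phi w a)%:E)).
have mJ : measurable_fun setT (fun a : V 3 => \int[lam n]_w (phi w a)%:E)%E.
  apply: (@ge0_measurable_integral _ _ _ _ _ (lam n) (fun a w => (phi w a)%:E));
      last by move=> x y; rewrite lee_fin.
  exact: (measurableT_comp mphi (measurable_fun_pair measurable_snd measurable_fst)).
have mA : measurable (shell `&` [set a : V 3 | (tnth a ord0 : R) != 0%R]).
  apply: measurableI; first exact: measurable_shell.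
  rewrite (_ : mkset _ = (fun a : V 3 => tnth a ord0) @^-1` (~` [set (0 : R)])).
    apply: measurable_preimageT; first exact: measurable_tnth.
    by apply: measurableC; exact: measurable_set1.
  by apply/seteqP; split => a /= /eqP.
have J1 (a : V 3) : (0 <= \int[lam n]_w (phi w a)%:E)%E.
  by apply: integral_ge0 => w _; rewrite lee_fin.
have [a [sa a0] Ja] := measure_pos_of_integral0 mJ J1 J0 mA shell_pos.
pose Q := (fun w : V n => tuple_mul (frame3 w) a) @^-1` high_energy.
have mQ : measurable Q by exact: measurable_preimageT.
have ZQ0 : lam n (Z `&` Q) = 0%E.
  rewrite -(integral_EFin_indic _ (measurableI _ _ mZ mQ)) -Ja.
  apply: eq_integral => w _; rewrite indicI /phi.
  have -> : \1_shell a = 1 :> R by rewrite indicE mem_set.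
  by rewrite mul1r.
have Q0 : lam n Q = 0%E.
  apply/eqP; rewrite eq_le measure_ge0 andbT.
  apply: (@le_trans _ _ (lam n ((Z `&` Q) `|` ~` Z))).
    apply: le_measure; rewrite ?inE//.
      by apply: measurableU; [exact: measurableI|exact: measurableC].
    by move=> w Qw; have [Zw|Zw] := pselect (Z w); [left|right].
  apply: le_trans (measureU2 _ _ _) _; [exact: measurableI|exact: measurableC|].
  rewrite -[leRHS]adde0; apply: leeD; first by rewrite [leLHS]ZQ0.
  rewrite -[leRHS]hyperplane0_null; apply: le_measure; rewrite ?inE.
  - exact: measurableC.
  - rewrite (_ : mkset _ = ~` Z); first exact: measurableC.
    by apply/seteqP; split => w /=; [move=> /eqP w0; apply/negP; rewrite negbK|move=> /negP;
        rewrite negbK => /eqP].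
  - by move=> w /negP; rewrite negbK => /eqP.
pose v := tuple_mul (frame3 [tuple 0 | _ < n]) a.
have ua : ((tnth a ord0)%:M : 'M[R]_n) \in unitmx.
  by rewrite unitmxE det_scalar unitfE expf_neq0.
have [c c0 Hc] := lebesgue_tuple_mul ua.
have mv : measurable_fun setT (fun t : V n => tuple_add t v) by exact: measurable_tuple_add.
have mS : measurable ((fun t => tuple_add t v) @^-1` high_energy) by exact:
    (measurable_preimageT mv mH).
have QE : Q = tuple_mul (tnth a ord0)%:M @^-1` ((fun t => tuple_add t v) @^-1` high_energy).
  by apply/seteqP; split => w; rewrite /Q /preimage /= frame3_affine.
have LQ : lam n Q = (c%:E * lam n ((fun t => tuple_add t v) @^-1` high_energy))%E.
  exact: (etrans (congr1 (lam n) QE) (Hc _ mS)).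
exact: pmule_eq0 c0 (etrans (esym (etrans LQ (congr1 (mule c%:E)
    (lebesgue_tuple_shift v mH)))) Q0).
Qed.

End high_energy_directions.

(** * Absolute continuity from bounded difference quotients *)

Section window_means.
Context {R : realType}.
Local Notation mu := (@lebesgue_measure R).
Implicit Types (a b c h k x : R).

Lemma ge0_integral_itv_cat (f : R -> \bar R) a b c : a <= c -> c <= b ->
  measurable_fun setT f -> (forall r, 0 <= f r)%E ->
  (\int[mu]_(r in `[a, b[) f r = \int[mu]_(r in `[a, c[) f r + \int[mu]_(r in `[c, b[) f r)%E.
Proof.
move=> ac cb mf f0; rewrite -ge0_integral_setU//=.
- congr (integral _ _ _); apply/seteqP; split => r /=; rewrite !in_itv/=.
    by move=> /andP[ar rb]; have [rc|cr] := ltP r c; [left|right]; rewrite ?ar ?rb.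
  by move=> [|] /andP[h1 h2]; rewrite ?h1 ?h2 ?(le_trans ac)// ?andbT (lt_le_trans h2).
- exact: measurable_funTS.
- apply/disj_setPS => r /= []; rewrite !in_itv/= => /andP[_ rc] /andP[cr _].
  by move: rc; rewrite ltNge cr.
Qed.

Lemma ge0_integral_itv_shift (f : R -> \bar R) a b h :
  measurable_fun setT f -> (forall r, 0 <= f r)%E ->
  (\int[mu]_(r in `[a, b[) f (r + h)%R = \int[mu]_(r in `[(a + h)%R, (b + h)%R[) f r)%E.
Proof.
move=> mf f0; rewrite integral_mkcond [RHS]integral_mkcond.
rewrite -[RHS](ge0_integral_lebesgue_shift h).
- apply: eq_integral => r _; rewrite !patchE !mem_setE !in_itv/= lerD2r ltrD2r.
  by [].
- by apply/(measurable_restrictT _ _).1 => //; exact: measurable_funTS.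
- by move=> r; rewrite patchE; case: ifP.
Qed.

Variables (s : R -> R) (m : R).
Hypothesis ms : measurable_fun setT s.
Hypothesis s0 : forall r, 0 <= s r.
Hypothesis sm : forall r, s r <= m.

Let mse : measurable_fun setT (fun r => (s r)%:E).
Proof. exact/measurable_EFinP. Qed.

Let se0 r : (0 <= (s r)%:E)%E.
Proof. by rewrite lee_fin. Qed.

Let fin_integral a b : (\int[mu]_(r in `[a, b[) (s r)%:E)%E \is a fin_num.
Proof.
rewrite ge0_fin_numE; last by apply: integral_ge0 => r _; rewrite lee_fin.
apply: (@le_lt_trans _ _ (\int[mu]_(r in `[a, b[) m%:E)%E).
  apply: ge0_le_integral => //.
  - exact: measurable_funTS.
  - by move=> r _; rewrite lee_fin.
rewrite integral_cst//= lebesgue_measure_itv/=.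
by case: ifP => _; rewrite ?mule0 ?ltry// -EFinB -EFinM ltry.
Qed.

Definition window_integral h x : R := fine (\int[mu]_(r in `[x, (x + h)%R[) (s r)%:E)%E.

Let window_integralE h x : (window_integral h x)%:E = (\int[mu]_(r in `[x, (x + h)%R[)
    (s r)%:E)%E.
Proof. by rewrite /window_integral fineK. Qed.

Lemma window_integral_increment k h a b : 0 < k -> 0 <= h -> a <= b ->
  (`|window_integral h b - window_integral h a|%:E <=
   \int[mu]_(r in `[a, b[) ((k * (s (r + h) - s r) ^+ 2 + k^-1) / 2)%R%:E)%E.
Proof.
move=> k0 h0 ab; set q := fun r => ((k * (s (r + h) - s r) ^+ 2 + k^-1) / 2).
have q0 r : 0 <= q r.
  apply: divr_ge0 => //; apply: addr_ge0; last by rewrite invr_ge0 ltW.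
  by apply: mulr_ge0; [exact: ltW|exact: sqr_ge0].
have mh : measurable_fun setT (fun r : R => s (r + h)).
  by apply: (measurableT_comp ms); exact: measurable_funD.
have mq : measurable_fun setT q.
  by apply: measurable_funM => //; apply: measurable_funD => //; apply: measurable_funM => //;
    apply: measurable_funX; exact: measurable_funB.
(* AM-GM: |u| <= (k u^2 + 1/k) / 2 *)
have absq r : `|s (r + h) - s r| <= q r.
  rewrite /q -(@real_normK _ (s (r + h) - s r)) ?num_real//.
  set t := `| _ |; rewrite ler_pdivlMr// -subr_ge0.
  have -> : k * t ^+ 2 + k^-1 - t * 2 = k^-1 * (k * t - 1) ^+ 2 by field; rewrite gt_eqF.
  by rewrite mulr_ge0 ?sqr_ge0// invr_ge0 ltW.
have key : ((window_integral h b)%:E + \int[mu]_(r in `[a, b[) (s r)%:E =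
    \int[mu]_(r in `[a, b[) (s (r + h)%R)%:E + (window_integral h a)%:E)%E.
  rewrite !window_integralE (ge0_integral_itv_shift _ _ _ mse)//.
  have bbh : b <= b + h by rewrite lerDl.
  have aah : a <= a + h by rewrite lerDl.
  have abh : a + h <= b + h by rewrite lerD2r.
  transitivity (\int[mu]_(r in `[a, (b + h)%R[) (s r)%:E)%E.
    by rewrite addeC; exact/esym/(ge0_integral_itv_cat ab bbh mse se0).
  by rewrite addeC; exact: (ge0_integral_itv_cat aah abh mse se0).
have fh : (\int[mu]_(r in `[a, b[) (s (r + h)%R)%:E)%E \is a fin_num.
  by rewrite (ge0_integral_itv_shift _ _ _ mse).
have up (u v : R -> R) : measurable_fun setT u -> measurable_fun setT v ->
    (forall r, 0 <= u r) -> (forall r, 0 <= v r) -> (forall r, u r <= v r + q r) ->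
    (\int[mu]_(r in `[a, b[) (u r)%:E <= \int[mu]_(r in `[a, b[)
        (v r)%:E + \int[mu]_(r in `[a, b[) (q r)%:E)%E.
  move=> mu1 mv u0 v0 uvq; rewrite -ge0_integralD//; last 4 first.
  - by move=> r _; rewrite lee_fin.
  - by apply/measurable_EFinP; exact: measurable_funTS.
  - by move=> r _; rewrite lee_fin.
  - by apply/measurable_EFinP; exact: measurable_funTS.
  apply: ge0_le_integral => //.
  - by move=> r _; rewrite lee_fin.
  - by apply/measurable_EFinP; exact: measurable_funTS.
  - by apply: emeasurable_funD; apply/measurable_EFinP; exact: measurable_funTS.
  - by move=> r _; rewrite -EFinD lee_fin.
have up1 := up _ _ mh ms (fun r => s0 _) s0.
have up2 := up _ _ ms mh s0 (fun r => s0 _).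
move: up1 up2 (fin_integral a b) fh key.
set u := (\int[mu]_(r in _) (s (_ + _))%:E)%E; set v := (\int[mu]_(r in _) (s _)%:E)%E.
move=> up1 up2 vfin ufin.
have {}up1 : (u <= v + \int[mu]_(r in `[a, b[) (q r)%:E)%E.
  by apply: up1 => r; rewrite -lerBlDl; apply: le_trans (absq r); exact: ler_norm.
have {}up2 : (v <= u + \int[mu]_(r in `[a, b[) (q r)%:E)%E.
  by apply: up2 => r; rewrite -lerBlDl; apply: le_trans (absq r); rewrite -normrN opprB;
      exact: ler_norm.
move: up1 up2; rewrite -(fineK ufin) -(fineK vfin) -!EFinD => up1 up2 -[key].
have : (0 <= \int[mu]_(r in `[a, b[) (q r)%:E)%E.
  by apply: integral_ge0 => r _; rewrite lee_fin.
case: (\int[mu]_(r in _) (q r)%:E)%E up1 up2 => [z| |] up1 up2 Q0; last 2 first.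
- by rewrite leey.
- by move: Q0; rewrite leNgt ltNy0.
move: up1 up2; rewrite -!EFinD !lee_fin ler_norml => up1 up2; apply/andP; split; lra.
Qed.

End window_means.

Section window_sums.
Context {R : realType}.
Local Notation mu := (@lebesgue_measure R).
Implicit Types (k h x : R).
Variables (s : R -> R) (m : R).
Hypothesis ms : measurable_fun setT s.
Hypothesis s0 : forall r, 0 <= s r.
Hypothesis sm : forall r, s r <= m.

Lemma window_integral_sum k h C (n : nat) (a b : 'I_n -> R) : 0 < k -> 0 <= h ->
  (\int[mu]_r ((s (r + h) - s r) ^+ 2)%R%:E <= C%:E)%E ->
  (forall i, a i <= b i) -> trivIset setT (fun i => `]a i, b i[%classic) ->
  \sum_i `|window_integral s h (b i) - window_integral s h (a i)| <=
  (k * C + k^-1 * \sum_i (b i - a i)) / 2.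
Proof.
move=> k0 h0 EC ab tab; rewrite -lee_fin -sumEFin.
pose D r := (s (r + h) - s r) ^+ 2.
have D0 r : 0 <= D r by exact: sqr_ge0.
have mD : measurable_fun setT D.
  apply: measurable_funX; apply: measurable_funB => //.
  by apply: (measurableT_comp ms); exact: measurable_funD.
have mDE A : measurable_fun A (fun r => (D r)%:E).
  by apply/measurable_EFinP; exact: measurable_funTS.
pose e i : \bar R := (\int[mu]_(r in `]a i, b i[) (D r)%:E)%E.
have e0 i : (0 <= e i)%E by apply: integral_ge0 => r _; rewrite lee_fin.
have k2 : 0 <= k / 2 by rewrite divr_ge0// ltW.
have ki2 : 0 <= k^-1 / 2 by rewrite divr_ge0// invr_ge0 ltW.
have H i : (`|window_integral s h (b i) - window_integral s h (a i)|%:E <=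
    (k / 2)%:E * e i + (k^-1 / 2 * (b i - a i))%:E)%E.
  apply: (le_trans (window_integral_increment ms s0 sm k0 h0 (ab i))).
  rewrite -integral_itv_obnd_cbnd; last first.
    by apply/measurable_EFinP; apply: measurable_funTS; apply: measurable_funM => //;
      apply: measurable_funD => //; exact: measurable_funM.
  rewrite -ge0_integralZl//=; last 2 first.
  - exact: mDE.
  - by move=> r _; rewrite lee_fin.
  have -> : ((k^-1 / 2 * (b i - a i))%:E = \int[mu]_(r in `]a i, b i[) (k^-1 / 2)%:E)%E.
    rewrite integral_cst//= lebesgue_measure_itv/= lte_fin; case: ltP => abi.
      by rewrite -EFinB -EFinM.
    by rewrite mule0; congr (_%:E);
        rewrite (le_anti (_ : a i <= b i <= a i)) ?ab ?abi// subrr mulr0.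
  rewrite -ge0_integralD//=; last 2 first.
  - by move=> r _; apply: mule_ge0; rewrite lee_fin.
  - by apply: emeasurable_funM => //; exact: mDE.
  rewrite le_eqVlt; apply/orP; left; apply/eqP; apply: eq_integral => r _.
  by rewrite -EFinM -EFinD; congr (_%:E); rewrite /D mulrDl mulrAC.
apply: (@le_trans _ _ (\sum_i ((k / 2)%:E * e i + (k^-1 / 2 * (b i - a i))%:E)))%E.
  by apply: lee_sum => i _; exact: H.
rewrite big_split/= -ge0_sume_distrr// sumEFin -mulr_sumr.
have -> : ((k * C + k^-1 * \sum_i (b i - a i)) / 2 = k / 2 * C + k^-1 / 2 * \sum_i (b i - a i)).
  by ring.
rewrite EFinD [(k / 2 * C)%:E]EFinM; apply: leeD2r; apply: lee_wpmul2l; first by rewrite lee_fin.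
apply: (le_trans _ EC).
have mI i : measurable `]a i, b i[%classic by exact: measurable_itv.
have De0 r : (0 <= (D r)%:E)%E by rewrite lee_fin.
have tI : trivIset [set` index_enum 'I_n] (fun i => `]a i, b i[%classic).
  exact: sub_trivIset tab.
have := @ge0_integral_bigsetU _ _ _ mu _ _ (fun r => (D r)%:E) _ mI (index_enum_uniq _) tI
    (mDE _).
move=> <-; last by move=> r _; exact: De0.
apply: ge0_subset_integral; [exact: bigsetU_measurable|exact: measurableT|exact: mDE| |exact:
    subsetT].
by move=> r _; exact: De0.
Qed.

End window_sums.

Section lebesgue_points.
Context {R : realType}.
Local Notation mu := (@lebesgue_measure R).
Variables (G : R -> R).
Hypothesis mG : measurable_fun setT G.
Hypothesis G0 : forall r, 0 <= G r.
Hypothesis intG : (\int[mu]_r (G r)%:E < +oo)%E.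

Definition window_mass h r : R := fine (\int[mu]_(y in `[r, (r + h)%R[) (G y)%:E)%E.

Let mGE A : measurable_fun A (fun r => (G r)%:E).
Proof. by apply/measurable_EFinP; exact: measurable_funTS. Qed.

Lemma window_mass_le_total h r :
  (\int[mu]_(y in `[r, (r + h)%R[) (G y)%:E <= \int[mu]_y (G y)%:E)%E.
Proof.
apply: ge0_subset_integral; [exact: measurable_itv|exact: measurableT|exact: mGE| |exact:
    subsetT].
by move=> y _; rewrite lee_fin.
Qed.

Lemma window_massE h r : (window_mass h r)%:E = (\int[mu]_(y in `[r, (r + h)%R[) (G y)%:E)%E.
Proof.
rewrite /window_mass fineK// ge0_fin_numE.
  exact: le_lt_trans (window_mass_le_total _ _) intG.
by apply: integral_ge0 => y _; rewrite lee_fin.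
Qed.

Lemma window_mass_ge0 h r : 0 <= window_mass h r.
Proof. by apply/fine_ge0/integral_ge0 => y _; rewrite lee_fin. Qed.

Lemma window_mass_le h r : window_mass h r <= fine (\int[mu]_y (G y)%:E)%E.
Proof.
rewrite -lee_fin window_massE fineK; first exact: window_mass_le_total.
by rewrite ge0_fin_numE//; apply: integral_ge0 => y _; rewrite lee_fin.
Qed.

End lebesgue_points.

Lemma ge0_integral_le_add d (T : measurableType d) (R : realType)
    (m : {measure set T -> \bar R}) (D : set T) (f g p : T -> R) :
  measurable D -> measurable_fun setT f -> measurable_fun setT g -> measurable_fun setT p ->
  (forall x, 0 <= f x) -> (forall x, 0 <= g x) -> (forall x, 0 <= p x) ->
  (forall x, D x -> f x <= g x + p x) ->
  (\int[m]_(x in D) (f x)%:E <= \int[m]_(x in D) (g x)%:E + \int[m]_(x in D) (p x)%:E)%E.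
Proof.
move=> mD mf mg mp f0 g0 p0 fgp.
have mE (u : T -> R) : measurable_fun setT u -> measurable_fun D (fun x => (u x)%:E).
  by move=> mu; apply/measurable_EFinP; exact: measurable_funTS.
rewrite -ge0_integralD//; [|by move=> x _; rewrite lee_fin|exact: mE|
  by move=> x _; rewrite lee_fin|exact: mE].
by apply: ge0_le_integral => //; first [exact: mE|by apply: emeasurable_funD; exact: mE
  |move=> x Dx; rewrite -?EFinD lee_fin; by [|exact: fgp]].
Qed.

Section lebesgue_points.
Context {R : realType}.
Local Notation mu := (@lebesgue_measure R).
Variables (G : R -> R).
Hypothesis mG : measurable_fun setT G.
Hypothesis G0 : forall r, 0 <= G r.
Hypothesis intG : (\int[mu]_r (G r)%:E < +oo)%E.

Lemma measurable_window_mass h : measurable_fun setT (window_mass G h).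
Proof.
apply: measurableT_comp => //.
rewrite [X in measurable_fun _ X](_ : _ =
  fun r => \int[mu]_y (window h r y * G y)%:E)%E; last first.
  apply/funext => r; rewrite integral_mkcond; apply: eq_integral => y _.
  rewrite patchE mem_setE in_itv/= /window; case: ifPn => _; first by rewrite mul1r.
  by rewrite mul0r.
apply: (measurable_fun_fubini_tonelli_F (m2 := mu)
  (fun p : measurableTypeR R * measurableTypeR R => (window h p.1 p.2 * G p.2)%:E)).
  apply/measurable_EFinP; apply: measurable_funM; first exact: measurable_fun_window.
  exact: measurableT_comp.
by move=> p; rewrite lee_fin mulr_ge0// window_ge0.
Qed.

Let integral_itv_cst x h c : 0 <= h ->
  (\int[mu]_(y in `[x, (x + h)%R[) c%:E = (c * h)%:E)%E.
Proof.
move=> h0; rewrite integral_cst//= lebesgue_measure_itv/= lte_fin; case: ltP => xh.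
  by rewrite -EFinB -EFinM addrAC subrr add0r.
by congr (_%:E); rewrite (_ : h = 0) ?mulr0//; lra.
Qed.

Lemma window_integral_lebesgue_pt h x : 0 < h ->
  (`|window_integral (window_mass G h) h x - h ^+ 2 * G x|%:E <=
   h%:E * \int[mu]_(y in ball x (h *+ 2)) `|G y - G x|%:E)%E.
Proof.
move=> h0; have h0' := ltW h0.
pose p y := `|G y - G x|.
have mp : measurable_fun setT p by apply: measurableT_comp => //; exact: measurable_funB.
have p0 y : 0 <= p y by exact: normr_ge0.
have Gp y : G y <= G x + p y by rewrite -lerBlDl ler_norm.
have pG y : G x <= G y + p y by rewrite -lerBlDl /p distrC ler_norm.
have ms := measurable_window_mass h.
have s0 := window_mass_ge0 G0 h.
have sm := window_mass_le mG G0 intG h.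
have : (0 <= \int[mu]_(y in ball x (h *+ 2)) (p y)%:E)%E.
  by apply: integral_ge0 => y _; rewrite lee_fin.
rewrite -[X in (_ <= _ * X)%E]/(\int[mu]_(y in ball x (h *+ 2)) (p y)%:E)%E.
case E : (\int[mu]_(y in ball x (h *+ 2)) (p y)%:E)%E => [e| |]; last 2 first.
- by move=> _; rewrite gt0_muley ?lte_fin// leey.
- by rewrite leNgt ltNy0.
rewrite lee_fin => e0.
have sub r : x <= r < x + h -> `[r, r + h[ `<=` ball x (h *+ 2).
  move=> /andP[xr rx] y /=; rewrite in_itv/= /ball/= => /andP[ry yr].
  by rewrite ltr_distlC mulr2n; apply/andP; split; lra.
have pe r : x <= r < x + h -> (\int[mu]_(y in `[r, (r + h)%R[) (p y)%:E <= e%:E)%E.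
  move=> xr; rewrite -E; apply: ge0_subset_integral;
      [exact: measurable_itv|exact: measurable_ball| | |exact: sub].
    by apply/measurable_EFinP; exact: measurable_funTS.
  by move=> y _; rewrite lee_fin.
have up r : x <= r < x + h -> window_mass G h r <= G x * h + e.
  move=> xr; rewrite -lee_fin window_massE// EFinD -(integral_itv_cst r _ h0').
  apply: le_trans (leeD2l _ (pe _ xr)).
  by apply: (@ge0_integral_le_add _ _ _ mu _ G (cst (G x)) p) => // y;
      first [exact: G0|move=> _; exact: Gp].
have dn r : x <= r < x + h -> G x * h <= window_mass G h r + e.
  move=> xr; rewrite -lee_fin EFinD window_massE// -(integral_itv_cst r _ h0').
  apply: le_trans (leeD2l _ (pe _ xr)).
  by apply: (@ge0_integral_le_add _ _ _ mu _ (cst (G x)) G p) => // y;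
      first [exact: G0|move=> _; exact: pG].
have IE : (window_integral (window_mass G h) h x)%:E =
    (\int[mu]_(r in `[x, (x + h)%R[) (window_mass G h r)%:E)%E.
  rewrite /window_integral fineK// ge0_fin_numE; last first.
    by apply: integral_ge0 => r _; rewrite lee_fin.
  apply: (@le_lt_trans _ _ (\int[mu]_(r in `[x, (x + h)%R[) (G x * h + e)%:E)%E); last first.
    by rewrite integral_itv_cst// ltry.
  apply: ge0_le_integral => //; first by move=> r _; rewrite lee_fin.
  by apply/measurable_EFinP; exact: measurable_funTS.
have Gh0 : 0 <= G x * h by rewrite mulr_ge0.
rewrite -EFinM lee_fin ler_norml; apply/andP; split.
  have : (\int[mu]_(r in `[x, (x + h)%R[) (G x * h)%:E <=
      \int[mu]_(r in `[x, (x + h)%R[) (window_mass G h r)%:E + \int[mu]_(r in `[x,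
          (x + h)%R[) e%:E)%E.
    apply: (@ge0_integral_le_add _ _ _ mu _ (cst (G x * h)) (window_mass G h) (cst e)) => // r;
        first [exact: dn|exact: Gh0|exact: s0|exact: e0].
  rewrite -IE !integral_itv_cst// -EFinD lee_fin; lra.
have : (\int[mu]_(r in `[x, (x + h)%R[) (window_mass G h r)%:E <=
    \int[mu]_(r in `[x, (x + h)%R[) (G x * h)%:E + \int[mu]_(r in `[x, (x + h)%R[) e%:E)%E.
  apply: (@ge0_integral_le_add _ _ _ mu _ (window_mass G h) (cst (G x * h)) (cst e)) => // r;
      first [exact: up|exact: Gh0|exact: s0|exact: e0].
rewrite -IE !integral_itv_cst// -EFinD lee_fin; lra.
Qed.

End lebesgue_points.

Section energy_absolutely_continuous.
Context {R : realType}.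
Local Notation mu := (@lebesgue_measure R).
Variables (G : R -> R).
Hypothesis mG : measurable_fun setT G.
Hypothesis G0 : forall r, 0 <= G r.
Hypothesis intG : (\int[mu]_r (G r)%:E < +oo)%E.

Definition mean_window h x : R := window_integral (window_mass G h) h x / h ^+ 2.

Let ms := measurable_window_mass mG G0.
Let s0 := window_mass_ge0 G0.
Let sm := window_mass_le mG G0 intG.

Lemma mean_window_sum (k h C : R) (n : nat) (a b : 'I_n -> R) : 0 < k -> 0 < h ->
  (\int[mu]_r ((window_mass G h (r + h) - window_mass G h r) ^+ 2)%R%:E <= (C * h ^+ 4)%:E)%E ->
  (forall i, a i <= b i) -> trivIset setT (fun i => `]a i, b i[%classic) ->
  \sum_i `|mean_window h (b i) - mean_window h (a i)| <=
  (k * C + k^-1 * \sum_i (b i - a i)) / 2.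
Proof.
move=> k0 h0 EC ab tab.
have kh0 : 0 < k / h ^+ 2 by rewrite divr_gt0// exprn_gt0.
have := window_integral_sum (ms h) (s0 h) (sm h) kh0 (ltW h0) EC ab tab.
set S := \sum_i (b i - a i).
have -> : (k / h ^+ 2 * (C * h ^+ 4) + (k / h ^+ 2)^-1 * S) / 2 = h ^+ 2 *
    ((k * C + k^-1 * S) / 2).
  by field; rewrite ?gt_eqF.
move=> H; rewrite -(ler_pM2l (exprn_gt0 2 h0)); apply: le_trans H.
rewrite mulr_sumr; apply: ler_sum => i _.
rewrite -[X in X * _]gtr0_norm ?exprn_gt0// -normrM mulrBr /mean_window.
by rewrite !(mulrC (h ^+ 2)) !divfK// gt_eqF// exprn_gt0.
Qed.

Lemma mean_window_lebesgue_pt (hs : nat -> R) x :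
  (forall k, 0 < hs k < k.+1%:R^-1) -> lebesgue_pt G x ->
  mean_window (hs k) x @[k --> \oo] --> G x.
Proof.
move=> hsP lx; apply/cvgrPdist_le => e e0.
have e4 : (0 < (e / 4)%:E)%E by rewrite lte_fin divr_gt0.
have [d /= d0 Hd] := lx _ (open_ereal_lt' e4).
near=> k.
have /andP[h0 hk] := hsP k.
have hd : hs k *+ 2 < d.
  apply: (@le_lt_trans _ _ (k.+1%:R^-1 *+ 2)); first by rewrite lerMn2r ltW.
  rewrite -[ltLHS]mulr_natr ltr_pdivrMl ?ltr0n// -ltr_pdivrMr//.
  apply: (@lt_trans _ _ k%:R); last by rewrite ltr_nat.
  by near: k; exact: nbhs_infty_gtr.
have h20 : 0 < hs k *+ 2 by rewrite mulrn_wgt0.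
have := Hd (hs k *+ 2).
rewrite /= /ball/= sub0r normrN (gtr0_norm h20) => /(_ hd h20).
rewrite /davg /iavg (lebesgue_measure_ball _ (ltW h20)) inver.
rewrite (negbTE (lt0r_neq0 _)); last by rewrite mulrn_wgt0.
set J := (\int[mu]_(y in _) _)%E => davgE.
have JE : J = (\int[mu]_(y in ball x (hs k *+ 2)) `|G y - G x|%:E)%E by [].
have := window_integral_lebesgue_pt mG G0 intG x h0; rewrite -JE.
have : (0 <= J)%E by apply: integral_ge0 => y _; exact: abse_ge0.
have c0 : 0 < (hs k *+ 2 *+ 2)^-1 by rewrite invr_gt0 !mulrn_wgt0.
move: davgE; case: (J) => [j| |]; last by [].
  rewrite -EFinM lte_fin lee_fin -EFinM lee_fin => je j0 Ij.
  have jhe : j <= hs k * e.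
    move: je; rewrite mulrC ltr_pdivrMr; last by rewrite !mulrn_wgt0.
    by move=> /ltW/le_trans; apply; rewrite le_eqVlt; apply/orP; left; apply/eqP; field.
  rewrite distrC /mean_window -[G x](mulfK (_ : hs k ^+ 2 != 0)); last first.
    by rewrite gt_eqF// exprn_gt0.
  rewrite -mulrBl normrM [X in _ * X]gtr0_norm ?invr_gt0 ?exprn_gt0//.
  rewrite ler_pdivrMr ?exprn_gt0// (mulrC (G x)) (le_trans Ij)//.
  by rewrite (_ : e * hs k ^+ 2 = hs k * (hs k * e)) ?ler_pM2l//; ring.
by rewrite gt0_muley ?lte_fin.
Unshelve. all: by end_near.
Qed.

(* The window means are absolutely continuous uniformly in k, and converge at
   the Lebesgue points of G, hence everywhere. *)
Lemma energy_absolutely_continuous (C : R) :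
  (forall n : nat, exists2 h : R, 0 < h < n.+1%:R^-1 &
    (\int[mu]_r ((window_mass G h (r + h) - window_mass G h r) ^+ 2)%R%:E <=
        (C * h ^+ 4)%:E)%E) ->
  exists2 g : R -> R, absolutely_continuous g & {ae mu, forall r, G r = g r}.
Proof.
move=> HC.
have {HC} /choice[hs hsP] n : exists h : R, 0 < h < n.+1%:R^-1 /\
    (\int[mu]_r ((window_mass G h (r + h) - window_mass G h r) ^+ 2)%R%:E <= (C * h ^+ 4)%:E)%E.
  by have [h h1 h2] := HC n; exists h.
have C0 : 0 <= C.
  have [/andP[h0 _] H] := hsP 0.
  rewrite -(pmulr_lge0 _ (exprn_gt0 4 h0)) -lee_fin (le_trans _ H)//.
  by apply: integral_ge0 => r _; rewrite lee_fin sqr_ge0.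
pose M k x := mean_window (hs k) x.
have sumM (e : R) : 0 < e -> exists2 d : R, 0 < d & forall k (n : nat) (a b : 'I_n -> R),
    (forall i, a i <= b i) -> trivIset setT (fun i => `]a i, b i[%classic) ->
    \sum_i (b i - a i) < d -> \sum_i `|M k (b i) - M k (a i)| <= e.
  move=> e0; pose c := e / (C + 1).
  have C1 : 0 < C + 1 by rewrite ltr_wpDl.
  have c0 : 0 < c by rewrite divr_gt0.
  exists (c * e); first by rewrite mulr_gt0.
  move=> k n a b ab tab Sd; have [/andP[h0 _] H] := hsP k.
  apply: (le_trans (mean_window_sum c0 h0 H ab tab)).
  rewrite ler_pdivrMr// mulrDr mulr1 lerD//.
    by rewrite /c -mulrA; apply: ler_piMr; [exact: ltW|rewrite ler_pdivrMl// mulr1 lerDl].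
  by rewrite ler_pdivrMl// ltW.
have aeL : {ae mu, forall x, M k x @[k --> \oo] --> G x}.
  have locG : locally_integrable setT G.
    apply: open_integrable_locally; first exact: openT.
    apply/integrableP; split; first exact/measurable_EFinP.
    by under eq_integral do rewrite /= ger0_norm//.
  apply: negligibleS (lebesgue_differentiation locG) => x /=; apply: contra_not => lx.
  by apply: mean_window_lebesgue_pt lx => k; have [] := hsP k.
have dense (x d : R) : 0 < d -> exists2 y, `|x - y| < d & M k y @[k --> \oo] --> G y.
  move=> d0; have [N [mN N0 NL]] := aeL; apply: contrapT => H.
  have : (mu (ball x d) <= mu N)%E.
    apply: le_measure; rewrite ?inE//; first exact: measurable_ball.
    by move=> y xy; apply: NL => My; apply: H; exists y.
  by rewrite N0 [leLHS](lebesgue_measure_ball x (ltW d0)) lee_fin leNgt mulrn_wgt0.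
have cvM x : cvgn (fun k => M k x).
  apply: cauchy_cvg; apply: cauchy_exP => e e0.
  have [d d0 Hd] := sumM _ (divr_gt0 e0 (ltr0Sn R 1)).
  have [y xy /cvgrPdist_lt My] := dense x d d0; exists (G y).
  have Mxy k : `|M k y - M k x| <= e / 2.
    have I1 (a b : R) : trivIset setT (fun _ : 'I_1 => `]a, b[%classic).
      by move=> i j _ _ _; rewrite !ord1.
    have [xley|/ltW ylex] := leP x y.
      have := Hd k 1%N (fun=> x) (fun=> y); rewrite !big_ord1; apply => //.
      by apply: le_lt_trans xy; rewrite distrC ler_norm.
    rewrite distrC; have := Hd k 1%N (fun=> y) (fun=> x); rewrite !big_ord1; apply => //.
    by rewrite (le_lt_trans (ler_norm _)).
  have := My _ (divr_gt0 e0 (ltr0Sn R 1)); apply: filterS => k Gk; rewrite /ball/=.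
  rewrite (splitr e) (le_lt_trans (ler_distD (M k y) _ _))// ltr_leD//.
pose g x : R := limn (fun k => M k x).
exists g; last first.
  by apply: negligibleS aeL => x /=; apply: contra_not => Mx; apply/esym/cvg_lim.
move=> e e0; have [d d0 Hd] := sumM _ (divr_gt0 e0 (ltr0Sn R 1)).
exists d => // n a b ab tab Sd.
apply: (@le_lt_trans _ _ (e / 2)); last by rewrite ltr_pdivrMr// ltr_pMr// ltr1n.
have cvS : \sum_i `|M k (b i) - M k (a i)| @[k --> \oo] --> \sum_i `|g (b i) - g (a i)|.
  apply: cvg_big => //; first exact: add_continuous.
  by move=> i _; apply: cvg_norm; apply: cvgB; exact: cvM.
by apply: (cvgr_to_le cvS); apply: nearW => k; exact: Hd.
Qed.

End energy_absolutely_continuous.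

(** * Slices and the Radon transform *)

Section slices.
Context {R : realType} (n : nat).
Local Notation V n := (n.-tuple (measurableTypeR R)).
Local Notation lam n := (lebesgue_tuple R n).
Local Notation mu := (@lebesgue_measure R).
Variable Q : 'M[R]_(n.+1).
Hypothesis uQ : Q \in unitmx.

Definition slice (E : set (V n.+1)) (r : R) : set (V n) :=
  [set y | E (tuple_mul Q (tuple_cons (r : measurableTypeR R, y)))].

Let measurable_slice_map : measurable_fun setT
  (fun p : measurableTypeR R * V n => tuple_mul Q (tuple_cons p)).
Proof. by apply: measurable_tuple_mul; exact: measurable_tuple_cons. Qed.

Lemma measurable_slice E r : measurable E -> measurable (slice E r).
Proof.
move=> mE.
have mr : measurable_fun setT (fun y : V n => tuple_mul Q (tuple_cons
    (r : measurableTypeR R, y))).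
  by apply: (measurableT_comp measurable_slice_map); exact: measurable_fun_pair.
exact: (measurable_preimageT mr mE).
Qed.

Lemma measurable_slice_measure E : measurable E ->
  measurable_fun setT (fun r : measurableTypeR R => lam n (slice E r)).
Proof.
move=> mE.
rewrite [X in measurable_fun _ X](_ : _ = fun r : measurableTypeR R => \int[lam n]_y
    (\1_E (tuple_mul Q (tuple_cons (r, y))))%:E)%E.
  apply: (@ge0_measurable_integral _ _ _ _ _ (lam n)
    (fun (r : measurableTypeR R) y => (\1_E (tuple_mul Q (tuple_cons (r, y))))%:E)).
    apply/measurable_EFinP; exact: measurable_indic_comp.
  by move=> r y; rewrite lee_fin.
by apply/funext => r; rewrite -(integral_EFin_indic _ (measurable_slice r mE)).
Qed.

Lemma integral_slice : exists2 c : R, 0 < c &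
  forall (E : set (V n.+1)) (D : set R), measurable E -> measurable D ->
  (\int[mu]_(r in D) lam n (slice E r) =
   c%:E * lam n.+1 (E `&` [set x | D (tnth (tuple_mul (invmx Q) x) ord0)]))%E.
Proof.
have [c c0 Hc] := lebesgue_tuple_mul uQ; exists c => // E D mE mD.
pose S := E `&` [set x | D (tnth (tuple_mul (invmx Q) x) ord0)].
have mi : measurable_fun setT (fun x : V n.+1 => tnth (tuple_mul (invmx Q) x) ord0).
  by apply: (measurableT_comp (@measurable_tnth _ _ _ ord0)); exact: measurable_tuple_mul.
have mS : measurable S by apply: measurableI => //; exact: (measurable_preimageT mi mD).
rewrite -/S -Hc//.
have mMS : measurable (tuple_mul Q @^-1` S).
  by apply: measurable_preimageT => //; exact: measurable_tuple_mul.
rewrite -(integral_EFin_indic _ mMS) ge0_integral_lebesgue_tupleS//;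
    last exact: measurable_EFin_indic.
rewrite integral_mkcond; apply: eq_integral => r _; rewrite patchE.
have SE (y : V n) : (\1_(tuple_mul Q @^-1` S) (tuple_cons (r : measurableTypeR R, y)) =
    \1_D r * \1_(slice E r) y :> R)%R.
  have P : S (tuple_mul Q (tuple_cons (r : measurableTypeR R, y))) <-> D r /\ slice E r y.
    by rewrite /S /setI /mkset tuple_mulK// tnth0; split => -[].
  rewrite !indicE -natrM mulnb; congr ((nat_of_bool _)%:R).
  by apply/idP/andP => [/set_mem/P[h1 h2]|[/set_mem h1 /set_mem h2]];
    [split; exact/mem_set|exact/mem_set/P].
under [RHS]eq_integral do rewrite SE EFinM.
rewrite ge0_integralZl//; last by apply: measurable_EFin_indic; exact: measurable_slice.
rewrite integral_EFin_indic; last exact: measurable_slice.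
by case: ifPn => rD; rewrite indicE ?rD ?(negbTE rD) ?mul1e// mul0e.
Qed.

End slices.

Section dilation.
Context {R : realType}.
Local Notation V n := (n.-tuple (measurableTypeR R)).
Local Notation lam n := (lebesgue_tuple R n).
Local Notation mu := (@lebesgue_measure R).

Lemma lebesgue_dilation_null (t : R) (A : set (measurableTypeR R)) : 0 < t ->
  measurable A -> mu A = 0%E -> mu [set r | A (t * r)] = 0%E.
Proof.
move=> t0 mA A0.
have E1 (D : set (measurableTypeR R)) : measurable D ->
    lam 1 [set z : V 1 | D (tnth z ord0)] = mu D.
  move=> mD; rewrite /= /cons_measure /pushforward.
  rewrite (_ : _ @^-1` _ = D `*` setT); last first.
    by apply/seteqP; split => [[x z]/=|[x z] [/= h _]]; rewrite tnth0//; split.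
  rewrite product_measure1E//.
  apply: (etrans (congr1 (fun z => _ * z)%E (_ : _ = 1%E)) (mule1 _)).
  by rewrite /= diracT.
have mt : measurable_fun setT (fun r : measurableTypeR R => t * r : measurableTypeR R).
  exact: mulrl_measurable.
have mtA : measurable [set r : measurableTypeR R | A (t * r)] by exact:
    (measurable_preimageT mt mA).
have ut : (t%:M : 'M[R]_1) \in unitmx.
  by rewrite unitmxE det_scalar unitfE expf_neq0// gt_eqF.
have [c c0 Hc] := lebesgue_tuple_mul ut.
have mA1 : measurable [set z : V 1 | A (tnth z ord0)].
  exact: (measurable_preimageT (@measurable_tnth _ _ _ _) mA).
have H := Hc _ mA1.
apply: (etrans (esym (E1 _ mtA))).
have -> : [set z : V 1 | [set r | A (t * r)] (tnth z ord0)] =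
    tuple_mul t%:M @^-1` [set z : V 1 | A (tnth z ord0)].
  by apply/seteqP; split => z /=; rewrite tnth_mktuple mul_mx_scalar !mxE.
apply: (etrans H); apply: (etrans (congr1 (fun z => _ * z)%E (etrans (E1 _ mA) A0))).
exact: mule0.
Qed.

Lemma absolutely_continuous_dilation (t : R) (g : R -> R) : 0 < t ->
  absolutely_continuous g -> absolutely_continuous (fun r => g (t * r)).
Proof.
move=> t0 acg e e0; have [d d0 Hd] := acg e e0.
exists (d / t) => [|n a b ab tab Sd]; first by rewrite divr_gt0.
apply: (Hd n (fun i => t * a i) (fun i => t * b i)).
- by move=> i; rewrite ler_pM2l.
- move=> i j _ _ [x []] /=; rewrite !in_itv/= => xi xj; apply: tab => //.
  by exists (x / t); split; rewrite /= in_itv/= ltr_pdivlMr// ltr_pdivrMr// ![_ * t]mulrC.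
- under eq_bigr do rewrite -mulrBr.
  by rewrite -mulr_sumr mulrC -ltr_pdivlMr.
Qed.

End dilation.

Section radon_direction.
Context {R : realType} (m : nat).
Let n := m.+3.
Local Notation V n := (n.-tuple (measurableTypeR R)).
Local Notation lam n := (lebesgue_tuple R n).
Local Notation mu := (@lebesgue_measure R).
Variables (K : set 'rV[R]_n) (B N : set (V n)).
Hypothesis mB : measurable B.
Hypothesis mN : measurable N.
Hypothesis N0 : lam n N = 0%E.
Hypothesis BK : B `<=` @row_of_tuple R n @^-1` K.
Hypothesis KBN : @row_of_tuple R n @^-1` K `<=` B `|` N.
Variable r0 : R.
Hypothesis r0_ge0 : 0 <= r0.
Hypothesis BC : B `<=` cube n r0.
Variables (theta : 'rV[R]_n) (t : R).
Hypothesis tt : scalar_product theta theta = 1.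
Hypothesis t0 : 0 < t.

Let w : V n := tuple_of_row (t *: theta).
Let Fr : 'M[R]_(m.+2, m.+3) := orthonormal_frame theta.

Let FrP : Fr *m Fr^T = 1%:M /\ Fr *m theta^T = 0.
Proof.
have [M HM] := @orthonormal_frame_exists R m.+2 theta tt.
exact: (@xgetPex _ 0 [set B : 'M[R]_(m.+2, m.+3) | B *m B^T = 1%:M /\ B *m theta^T = 0]
    (ex_intro _ M HM)).
Qed.

Let Q : 'M[R]_(m.+3) := col_mx (t^-1 *: theta) Fr.

Let Q_cons (r : R) (y : V m.+2) :
  row_of_tuple (tuple_mul Q (tuple_cons (r : measurableTypeR R, y))) =
  (r / t) *: theta + row_of_tuple y *m Fr.
Proof.
rewrite tuple_of_rowK.
have -> : row_of_tuple (tuple_cons (r : measurableTypeR R, y)) =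
    row_mx (r%:M : 'M[R]_1) (row_of_tuple y) :> 'rV[R]_(1 + m.+2).
  apply/rowP => i; rewrite mxE; case: (split_ordP i) => [j ->|j ->].
    rewrite row_mxEl mxE ord1 eqxx mulr1n.
    have -> : lshift m.+2 (0 : 'I_1) = (ord0 : 'I_m.+3) :> 'I_(1 + m.+2) by exact/val_inj.
    exact: tnth0.
  rewrite row_mxEr mxE.
  have -> : rshift 1 j = (lift ord0 j : 'I_m.+3) :> 'I_(1 + m.+2) by exact/val_inj.
  exact: tnthS.
have E : row_mx (r%:M : 'M[R]_1) (row_of_tuple y) *m col_mx (t^-1 *: theta) Fr =
    (r / t) *: theta + row_of_tuple y *m Fr.
  by rewrite mul_row_col mul_scalar_mx scalerA.
exact: E.
Qed.

Let uQ : Q \in unitmx.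
Proof.
have [FF Ft] := FrP.
have E : col_mx (t^-1 *: theta) Fr *m row_mx (t *: theta^T) Fr^T = 1%:M.
  rewrite mul_col_row FF -!scalemxAr Ft scaler0 -!scalemxAl mulmx_trE tt.
  rewrite scalerA mulfV ?gt_eqF// scale1r scalar_mx_block; congr block_mx.
  by rewrite -[RHS](scaler0 _ (t^-1)) -[in RHS]trmx0 -Ft trmx_mul trmxK.
pose Q' : 'M[R]_(m.+3) := row_mx (t *: theta^T) Fr^T.
have QQ : Q *m Q' = 1%:M by exact: E.
by have [] := mulmx1_unit QQ.
Qed.

Let Fr_theta (y : 'rV[R]_(m.+2)) : scalar_product (y *m Fr) theta = 0.
Proof. by have [_ Ft] := FrP; rewrite scalar_productE -mulmxA Ft mulmx0 mxE. Qed.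

Let coordinateE (x : V n) : tnth (tuple_mul (invmx Q) x) ord0 = tdot x w :> R.
Proof.
pose z := tuple_mul (invmx Q) x.
have xE : x = tuple_mul Q z.
  have uiQ : invmx Q \in unitmx by rewrite unitmx_inv.
  by have := tuple_mulK uiQ x; rewrite invmxK.
have zE : z = tuple_cons (thead z, [tuple of behead z]).
  by apply/val_inj; exact: (congr1 val (tuple_eta z)).
have E : tdot (tuple_mul Q (tuple_cons (thead z, [tuple of behead z]))) w = thead z.
  rewrite /tdot Q_cons tuple_of_rowK scalar_productZr scalar_productDl.
  by rewrite Fr_theta addr0 scalar_productZl tt mulr1 mulrC divfK// gt_eqF.
by rewrite [in RHS]xE [in RHS]zE E.
Qed.

Let slice_in_cube : exists2 s : R, 0 <= s & forall r, slice Q B r `<=` cube m.+2 s.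
Proof.
have [s s0 Hs] := @tuple_mul_cube R n (invmx Q) r0 r0_ge0.
exists s => // r y Hy i.
have Cz : cube n s (tuple_cons (r : measurableTypeR R, y)).
  apply: Hs; exists (tuple_mul Q (tuple_cons (r : measurableTypeR R, y))); first exact: BC.
  by rewrite tuple_mulK.
by have := Cz (lift ord0 i); rewrite tnthS.
Qed.

Definition slice_density (r : R) : R := fine (lam m.+2 (slice Q B r)).

Let slice_densityE r : (slice_density r)%:E = lam m.+2 (slice Q B r).
Proof.
rewrite /slice_density fineK// ge0_fin_numE//.
have [s s0 Hs] := slice_in_cube.
apply: (@le_lt_trans _ _ (lam m.+2 (cube m.+2 s))).
  by apply: le_measure; rewrite ?inE//; [exact: measurable_slice|exact: measurable_cube].
by rewrite lebesgue_tuple_cube// ltry.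
Qed.

Lemma slice_density_absolutely_continuous : ~ high_energy B w ->
  exists2 g : R -> R, absolutely_continuous g &
    {ae mu, forall r, slice_density r = g r}.
Proof.
move=> hw.
have finB : lam n B \is a fin_num by exact: (bounded_fin_num mB r0_ge0 BC).
have [c c0 Hc] := integral_slice uQ.
have mG : measurable_fun setT slice_density.
  by apply: measurableT_comp => //; exact: measurable_slice_measure.
have G0 r : 0 <= slice_density r by exact: fine_ge0.
have IG (D : set R) : measurable D -> (\int[mu]_(r in D) (slice_density r)%:E =
    c%:E * lam n (B `&` [set x | D (tdot x w)]))%E.
  move=> mD; under eq_integral do rewrite slice_densityE.
  apply: (etrans (Hc B D mB mD)); apply: (congr1 (fun S => c%:E * lam n S)%E).
  by apply/seteqP; split => x [Bx] /=; rewrite coordinateE.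
have intG : (\int[mu]_r (slice_density r)%:E < +oo)%E.
  have -> := IG setT measurableT; apply: lte_mul_pinfty; first by rewrite lee_fin ltW.
    by [].
  have -> : B `&` [set x | setT (tdot x w)] = B by apply/seteqP; split => x; [case|].
  by rewrite -ge0_fin_numE.
have massE h r : window_mass slice_density h r = c * slab B h w r.
  apply: EFin_inj; rewrite window_massE// EFinM -slab_massE//.
  have mI : measurable (`[r, r + h[%classic : set R) by exact: measurable_itv.
  rewrite (IG _ mI); apply: (congr1 (mule c%:E)).
  have mx : measurable_fun setT (fun x : V n => tdot x w) by exact: measurable_tdot.
  have mS : measurable (B `&` [set x | `[r, r + h[%classic (tdot x w)]).
    by apply: measurableI => //; exact: (measurable_preimageT mx mI).
  rewrite -(integral_EFin_indic _ mS); apply: eq_integral => x _; congr (_%:E).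
  rewrite indicI /=; congr (_ * _); rewrite indicE /window; congr ((nat_of_bool _)%:R).
  by apply/idP/idP; rewrite inE /= in_itv.
have [C HC] : exists C : R, (limn_einf (energy_rate B ^~ w) < C%:E)%E.
  case E : (limn_einf (energy_rate B ^~ w)) => [l| |].
  - by exists (l + 1); rewrite lte_fin ltrDl.
  - by case: hw.
  - by exists 0; rewrite ltNyr.
apply: (energy_absolutely_continuous mG G0 intG (C := c ^+ 2 * C)) => N1.
have [k Nk Hk] := limn_einf_ltP HC N1.
exists (@mesh R k).
  rewrite mesh_gt0/= /mesh ltf_pV2 ?posrE// ltr_nat.
  by rewrite !ltnS.
have s4 : 0 < @mesh R k ^+ 4 by rewrite exprn_gt0// mesh_gt0.
have -> : (\int[mu]_r ((window_mass slice_density (@mesh R k) (r + @mesh R k) -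
    window_mass slice_density (@mesh R k) r) ^+ 2)%:E = (c ^+ 2)%:E * slab_energy B
        (@mesh R k) w)%E.
  rewrite /slab_energy -ge0_integralZl//.
  - by apply: eq_integral => r _; rewrite !massE -mulrBr exprMn EFinM.
  - by apply/measurable_EFinP; apply: measurable_funX; apply: measurable_funB;
      apply: measurable_slab => //; exact: measurable_funD.
  - by move=> r _; rewrite lee_fin sqr_ge0.
  - by rewrite lee_fin sqr_ge0.
rewrite [leRHS](_ : _ = (c ^+ 2)%:E * (C * @mesh R k ^+ 4)%:E)%E; last first.
  by rewrite -EFinM; congr (_%:E); ring.
apply: lee_wpmul2l; first by rewrite lee_fin sqr_ge0.
by move: Hk; rewrite /energy_rate lte_pdivrMl// => /ltW; rewrite -EFinM mulrC.
Qed.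

Lemma radon_slice (r : R) : lam m.+2 (slice Q N (t * r)) = 0%E ->
  radon K theta r = (slice_density (t * r))%:E.
Proof.
move=> Nr; pose S : set (V m.+2) := @row_of_tuple R m.+2 @^-1`
  [set y | (K `&` hyperplane theta r) (r *: theta + y *m Fr)].
have -> : radon K theta r = ((lam m.+2)^*)%mu S by [].
have sliceE (y : V m.+2) : row_of_tuple (tuple_mul Q (tuple_cons
    ((t * r : R) : measurableTypeR R, y))) =
    r *: theta + row_of_tuple y *m Fr.
  by rewrite Q_cons (mulrC t) mulfK// gt_eqF.
have mSB := measurable_slice Q (t * r) mB.
have mSN := measurable_slice Q (t * r) mN.
have BS : slice Q B (t * r) `<=` S.
  move=> y By; rewrite /S /preimage /mkset -sliceE; split; first exact: BK By.
  rewrite /hyperplane /mkset sliceE scalar_productDl Fr_theta addr0 scalar_productZl tt.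
  exact: mulr1.
have SBN : S `<=` slice Q B (t * r) `|` slice Q N (t * r).
  by move=> y; rewrite /S /preimage /mkset -sliceE => -[Ky _]; exact: (KBN Ky).
apply/eqP; rewrite eq_le slice_densityE; apply/andP; split.
  apply: (le_trans (le_mu_ext (lam m.+2) SBN)).
  rewrite measurable_mu_extE; last exact: measurableU.
  apply: (le_trans (measureU2 _ mSB mSN)).
  by rewrite -[leRHS]adde0; apply: leeD => //; rewrite [leLHS]Nr.
by have := le_mu_ext (lam m.+2) BS; rewrite measurable_mu_extE.
Qed.

Lemma radon_absolutely_continuous : ~ high_energy B w ->
  ae_absolutely_continuous (radon K theta).
Proof.
move=> hw; have [g acg [Z [mZ Z0 GZ]]] := slice_density_absolutely_continuous hw.
exists (fun r => g (t * r)); first exact: absolutely_continuous_dilation.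
pose f (r : measurableTypeR R) := lam m.+2 (slice Q N r).
have mf : measurable_fun setT f by exact: measurable_slice_measure.
have f0 r : (0 <= f r)%E by [].
have If : (\int[mu]_r f r = 0)%E.
  have [c c0 Hc] := integral_slice uQ.
  apply: (etrans (Hc N setT mN measurableT)).
  have E : N `&` [set x : V n | setT (tnth (tuple_mul (invmx Q) x) ord0)] = N.
    by apply/seteqP; split => x; [case|].
  apply: (etrans (congr1 (fun S => c%:E * lam n S)%E E)).
  by apply: (etrans (congr1 (mule c%:E) N0)); exact: mule0.
have [Y [mY Y0 fY]] : mu.-negligible [set r | f r <> 0%E].
  have : ae_eq mu setT f (cst 0%E).
    by apply/ae_eq_integral_abs => //; under eq_integral do rewrite gee0_abs//.
  by apply: negligibleS => r /= fr h; exact: fr (h I).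
have mt : measurable_fun setT (fun r : measurableTypeR R => t * r : measurableTypeR R).
  exact: mulrl_measurable.
apply: (@negligibleS _ _ _ mu ([set r | Z (t * r)] `|` [set r | Y (t * r)])); last first.
  apply: negligibleU.
    by apply/negligibleP; [exact: (measurable_preimageT mt mZ)|exact: lebesgue_dilation_null].
  by apply/negligibleP; [exact: (measurable_preimageT mt mY)|exact: lebesgue_dilation_null].
move=> r /= Hr; have [fr|fr] := pselect (f (t * r) = 0%E); last by right; exact: fY.
left; apply: GZ => /= Gr; apply: Hr.
by rewrite radon_slice// Gr.
Qed.

End radon_direction.

Lemma bounded_set_cube (R : realType) n (K : set 'rV[R]_n) : bounded_set K ->
  exists2 r : R, 0 <= r & @row_of_tuple R n @^-1` K `<=` cube n r.
Proof.
move=> [M [_ HM]]; exists (`|M| + 1); first by rewrite addr_ge0.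
move=> x Kx i; rewrite -ler_norml.
have Mx := HM (`|M| + 1) (le_lt_trans (ler_norm M) (ltr_pwDr ltr01 (lexx _))) _ Kx.
apply: le_trans Mx; rewrite [leRHS]mx_normrE.
apply: le_trans (le_bigmax _ _ (ord0, i)) => /=.
by rewrite mxE.
Qed.

Unset Implicit Arguments.

Theorem theorem5p7 (R : realType) (d : nat) (hd : (3 <= d)%N)
    (K : set 'rV[R]_d) (K_bounded : bounded_set K)
    (K_measurable : lebesgue_measurable_rV K) :
  ae_sphere (fun theta : 'rV[R]_d => ae_absolutely_continuous (radon K theta)).
Proof.
case: d hd K K_bounded K_measurable => [|[|[|m]]] // _ K Kb [B mB [N0 [N [mN NE0 N0N]] KE]].
have [r r0 Kr] := bounded_set_cube Kb.
have BK : B `<=` @row_of_tuple R m.+3 @^-1` K by rewrite -KE; exact: subsetUl.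
have KBN : @row_of_tuple R m.+3 @^-1` K `<=` B `|` N by rewrite -KE; exact: setUS.
have BC : B `<=` cube m.+3 r by exact: subset_trans Kr.
rewrite /ae_sphere /surface_measure /lebesgue_rV.
set bad := [set theta | _].
suff -> : ((lebesgue_tuple R m.+3)^*)%mu
  (@row_of_tuple R m.+3 @^-1` cone (@unit_sphere R m.+3 `&` bad)) = 0%E by rewrite mule0.
have mH := measurable_high_energy mB.
have mC := @measurable_cube R m.+3 0.
apply/eqP; rewrite eq_le; apply/andP; split; last exact: mu_ext_ge0.
have sub : @row_of_tuple R m.+3 @^-1` cone (@unit_sphere R m.+3 `&` bad) `<=`
    high_energy B `|` cube m.+3 0.
  move=> x [t /andP[t0 _] [e [ee be] xe]]; move: t0; rewrite le_eqVlt => /predU1P[t0|t0].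
    right => i; have : row_of_tuple x 0 i = 0 by rewrite xe -t0 scale0r mxE.
    by rewrite mxE => ->; rewrite oppr0 lexx.
  left; apply: contrapT => hx; apply: be.
  apply: (radon_absolutely_continuous mB mN NE0 BK KBN r0 BC ee t0).
  by rewrite -xe row_of_tupleK.
apply: (le_trans (le_mu_ext (lebesgue_tuple R m.+3) sub)).
rewrite measurable_mu_extE; last exact: measurableU.
apply: (le_trans (measureU2 _ mH mC)); rewrite -[leRHS]adde0; apply: leeD.
  by rewrite [leLHS](high_energy_null mB r0 BC).
by rewrite [leLHS](lebesgue_tuple_cube _ (lexx 0)) mul0rn expr0n.
Qed.
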